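(* Assume that $Z_{2n}\stackrel{d}{=}Z_n+I$ for all $n\ge1$, where $I\sim\mathrm{Bernoulli}(1/2)$ is independent of $Z_n$. Then, for each fixed integer $m\ge1$, as $n\to\infty$, $$\sum_{0\le k\le\lambda}\left|\mathbb{P}(Z_n=k)-\sum_{0\le r<m}(-1)^r b_r(n)\,2^{-\lambda}\Delta^r\binom{\lambda}{k}\right|=\frac{h_m\,|b_m(n)|}{\lambda^{m/2}}+O\left(\lambda^{-(m+1)/2}\right),$$ where the sequence $b_r(n)=b_r(2n)$ is defined by $$\mathbb{E}(y^{Z_n})\left(\frac{1+y}{2}\right)^{-\lambda}=\sum_{r\ge0}b_r(n)(y-1)^r .$$
   Context: Each nonnegative integer is encoded by a different binary string; $\mu(j)$ denotes the number of 1s in the string encoding $j$. For $n\ge1$, $Z_n$ is the random variable $\mu(U_n)$ with $U_n$ uniform on $\{0,1,\ldots,n-1\}$, i.e. $\mathbb{P}(Z_n=k)=\frac1n\#\{0\le j<n:\mu(j)=k\}$. By convention $Z_0=Z_1=0$ (so $\mu(0)=0$). $\lambda=\lfloor\log_2 n\rfloor$. $\Delta$ is the difference operator: $\Delta^r\binom{\lambda}{k}=\sum_{0\le \ell\le r}\binom{r}{\ell}(-1)^\ell\binom{\lambda}{k-\ell}$, with $\binom{\lambda}{i}=0$ for $i<0$ or $i>\lambda$. $H_m(x)=(-1)^m e^{x^2/2}\frac{d^m}{dx^m}e^{-x^2/2}$ are the Hermite polynomials and $$h_m=\frac{2^{m}}{\sqrt{2\pi}}\int_{-\infty}^{\infty}|H_m(x)|e^{-x^2/2}\,dx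 .$$ *)

(* Defs.v *)
From HB Require Import structures.
From mathcomp Require Import all_boot all_order all_algebra.
From mathcomp Require Import all_classical all_reals all_analysis.
Set Implicit Arguments.
Unset Strict Implicit.
Unset Printing Implicit Defensive.
Import Order.TTheory GRing.Theory Num.Theory.
Import numFieldNormedType.Exports.
Local Open Scope classical_set_scope.
Local Open Scope ring_scope.

Definition ones (code : nat -> seq bool) (j : nat) : nat :=
  count_mem true (code j).

(* P(Z_n = k), where Z_n = mu(U_n) and U_n is uniform on {0, ..., n-1};
   meaningful only for n >= 1. *)
Definition prZ (R : realType) (mu : nat -> nat) (n k : nat) : R :=
  #|[set j : 'I_n | mu j == k]|%:R / n%:R.

(* E(y^{Z_n}), the average of y^{mu(U_n)} over the values of U_n. *)
Definition pgfZ (R : realType) (mu : nat -> nat) (n : nat) (y : R) : R :=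
  (\sum_(j < n) y ^+ mu j) / n%:R.

Definition has_pmf d (T : measurableType d) (R : realType)
    (P : probability T R) (X : T -> nat) (p : nat -> R) : Prop :=
  forall k : nat, P (X @^-1` [set k]) = (p k)%:E.

Definition independent_RV d (T : measurableType d) (R : realType)
    (P : probability T R) d1 (T1 : measurableType d1) d2
    (T2 : measurableType d2) (X : {RV P >-> T1}) (Y : {RV P >-> T2}) : Prop :=
  forall (A : set T1) (B : set T2), measurable A -> measurable B ->
    P (X @^-1` A `&` Y @^-1` B) = (P (X @^-1` A) * P (Y @^-1` B))%E.

(* Z_{2n} =d Z_n + I with I ~ Bernoulli(1/2) independent of Z_n. The pair
   (Z_n, I) is realized on some probability space; which one is immaterial,
   as the law of Z_n + I is determined by the laws of Z_n and I. The bool I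
   is coerced to 0 or 1 in the sum. *)
Definition doubling (R : realType) (mu : nat -> nat) (n : nat) : Prop :=
  exists (d : measure_display) (T : measurableType d) (P : probability T R)
         (Z : {RV P >-> nat}) (I : {RV P >-> bool}),
    [/\ has_pmf P Z (@prZ R mu n),
        distribution P I = bernoulli_prob (2^-1 : R) :> (set bool -> \bar R),
        independent_RV Z I
      & has_pmf P (fun w => (Z w + I w)%N) (@prZ R mu (2 * n))].

(* trunc_log 2 n is the floor of the binary logarithm of n >= 1 *)
Definition lambda (n : nat) : nat := trunc_log 2 n.

(* Delta^r binom(N, k). The test l <= k is needed because k - l is a truncated
   subtraction; 'C(N, i) is already 0 for i > N. *)
Definition diff_bin (R : realType) (r N k : nat) : R :=
  \sum_(l < r.+1)
    'C(r, l)%:R * (-1) ^+ l * (if (l <= k)%N then 'C(N, k - l)%:R else 0).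

Definition hermite (R : realType) (m : nat) (x : R) : R :=
  (-1) ^+ m * expR (x ^+ 2 / 2)
    * derive1n m (fun t : R => expR (- (t ^+ 2 / 2))) x.

Definition hconst (R : realType) (m : nat) : R :=
  2 ^+ m / Num.sqrt (2 * pi)
    * \int[lebesgue_measure]_(x in [set: R])
        (`|hermite m x| * expR (- (x ^+ 2 / 2))).

(* b r n is the coefficient of (y-1)^r in the expansion at y = 1 of
   E(y^{Z_n}) ((1+y)/2)^{-lambda}. Convergence on a neighbourhood of 1
   determines the sequence b^~ n uniquely. *)
Definition is_expansion (R : realType) (mu : nat -> nat)
    (b : nat -> nat -> R) (n : nat) : Prop :=
  \forall y \near (1 : R),
    series (fun r => b r n * (y - 1) ^+ r) @ \oo
      --> pgfZ mu n y * ((1 + y) / 2) ^- lambda n.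

Definition l1_error (R : realType) (mu : nat -> nat) (b : nat -> nat -> R)
    (m n : nat) : R :=
  \sum_(k < (lambda n).+1)
    `|prZ R mu n k
      - \sum_(r < m) (-1) ^+ r * b r n * 2 ^- lambda n
                       * diff_bin R r (lambda n) k|.

(* Main.v *)
Require Import Defs.
From HB Require Import structures.
From mathcomp Require Import all_boot all_order all_algebra.
From mathcomp Require Import all_classical all_reals all_analysis.
From mathcomp Require Import measurable_realfun zify ring lra.
Set Implicit Arguments.
Unset Strict Implicit.
Unset Printing Implicit Defensive.
Import Order.TTheory GRing.Theory Num.Theory.
Import numFieldNormedType.Exports.
Local Open Scope classical_set_scope.
Local Open Scope ring_scope.

(** Write [S_n] for the sum of [X^mu(j)] over [j < n], [L_N] for
[((1 + X) / 2)^N] and [U] for [X - 1]. The law of [Z_n] has generating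
polynomial [S_n / n], and the polynomial with coefficients
[(-1)^r 2^(-N) Delta^r binom(N, k)] is [L_N U^r]. Up to a few
extreme coefficients, which are negligible, the theorem is thus about the sum
of the absolute values of the coefficients, [norm1], of
[S_n / n - sum_(r < m) b_r(n) L_lambda U^r]. This polynomial is
[b_m(n) L_lambda U^m] plus a remainder of order [m + 1], and it is to be shown
that the first has norm [h_m |b_m(n)| lambda^(-m/2)], up to the stated error,
while the second is [O(lambda^(-(m+1)/2))], uniformly in [n].

The remainder. Doubling says that [S_2n = (1 + X) S_n]. Cutting along the
binary digits of [n], [S_n / n] is a combination of [L_(lambda-j) X^c] with
[c <= j + 1] and weights at most [2^(-j)] ([genpoly_digits]). Subtracting from
[X^c] the Taylor polynomial of [X^c / L_j] times [L_j] leaves a multiple of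
[U^(m+1)] whose cofactor has norm polynomial in [j] ([taylor_quotient]), and
[L_(lambda-j) U^(m+1)] has norm [O((lambda-j+1)^(-(m+1)/2))]
([norm1_diffpoly]). The weights make the sum over [j] converge
([genpoly_taylor]). The coefficients of these Taylor polynomials are the
numbers [b_r(n)], because an expansion at 1 is unique ([expansion_remainder],
[taylor_unique]); this bounds them uniformly in [n] and also shows that
[b_r(n) = b_r(2n)].

The main term. With [M = N + m], the coefficients of [(1 - X)^m (1 + X)^N] are
[binom(M, k)] times normalized Krawtchouk polynomials, whose recurrence in [m]
is a perturbation of size [1 / M] of the one of Hermite polynomials in the
standardized variable [x_k] ([krawp_hermite]). Up to normalization the norm of
[L_N U^m] is therefore the mean of [|H_m(x_k)|] under the binomial law, with an
error controlled by moments. It remains to replace this law by the Gaussian one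
at the cost of [O(M^(-1/2))], for a test function which is not smooth. Stein's
method does this ([binomial_gauss_absH]): for [g = |H_m|] with Gaussian mean
[c], the solution [f] of [f' - x f = g - c] and its derivative grow
polynomially, [f'] is locally Lipschitz, and summation by parts for the
binomial law shows that the binomial mean of [f' - x f] is [O(M^(-1/2))]
([discrete_stein]). *)

(** * Absolute sums of coefficients *)

Definition norm1 (R : realType) (p : {poly R}) : R :=
  \sum_(i < size p) `|p`_i|.

Lemma norm1E (R : realType) (p : {poly R}) K : (size p <= K)%N ->
  norm1 p = \sum_(i < K) `|p`_i|.
Proof.
move=> pK; rewrite /norm1 (big_ord_widen K (fun i => `|p`_i|)) // big_mkcond /=.
apply: eq_bigr => i _; case: ifPn => //; rewrite -leqNgt => pi.
by rewrite nth_default // normr0.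
Qed.

Lemma norm1_ge0 (R : realType) (p : {poly R}) : 0 <= norm1 p.
Proof. by apply: sumr_ge0 => i _; exact: normr_ge0. Qed.

Lemma ler_norm1D (R : realType) (p q : {poly R}) :
  norm1 (p + q) <= norm1 p + norm1 q.
Proof.
set K := maxn (size p) (size q).
rewrite (@norm1E _ (p + q) K) ?size_polyD // (@norm1E _ p K) ?leq_maxl //.
rewrite (@norm1E _ q K) ?leq_maxr // -big_split /=.
by apply: ler_sum => i _; rewrite coefD ler_normD.
Qed.

Lemma norm1Z (R : realType) a (p : {poly R}) :
  norm1 (a *: p) = `|a| * norm1 p.
Proof.
rewrite (@norm1E _ _ (size p)) ?size_scale_leq // mulr_sumr.
by apply: eq_bigr => i _; rewrite coefZ normrM.
Qed.

Lemma norm1N (R : realType) (p : {poly R}) : norm1 (- p) = norm1 p.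
Proof. by rewrite -scaleN1r norm1Z normrN1 mul1r. Qed.

Lemma ler_norm1B (R : realType) (p q : {poly R}) :
  norm1 (p - q) <= norm1 p + norm1 q.
Proof. by rewrite -(norm1N q) ler_norm1D. Qed.

Lemma norm10 (R : realType) : norm1 (0 : {poly R}) = 0.
Proof. by rewrite /norm1 size_poly0 big_ord0. Qed.

Lemma ler_norm1_sum (R : realType) (I : Type) (r : seq I) (P : pred I)
    (F : I -> {poly R}) :
  norm1 (\sum_(i <- r | P i) F i) <= \sum_(i <- r | P i) norm1 (F i).
Proof.
elim/big_ind2 : _ => [|x1 x2 y1 y2 h1 h2|//]; first by rewrite norm10.
by apply: le_trans (ler_norm1D _ _) _; exact: lerD.
Qed.

Lemma norm1XnM (R : realType) n (p : {poly R}) : norm1 ('X^n * p) = norm1 p.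
Proof.
have [->|p0] := eqVneq p 0; first by rewrite mulr0.
rewrite /norm1 size_monicM ?monicXn // size_polyXn addSn /= big_split_ord /=.
rewrite big1 ?add0r => [|i _]; last first.
  by rewrite coefXnM ltn_ord normr0.
by apply: eq_bigr => i _; rewrite coefXnM ltnNge leq_addr /= addKn.
Qed.

Lemma norm1Xn (R : realType) n : norm1 ('X^n : {poly R}) = 1.
Proof.
rewrite -[X in norm1 X]mulr1 norm1XnM /norm1 size_poly1 big_ord1.
by rewrite coef1 normr1.
Qed.

Lemma norm11 (R : realType) : norm1 (1 : {poly R}) = 1.
Proof. by rewrite -(expr0 'X) norm1Xn. Qed.

(** [norm1 p] is the operator norm of the convolution by the coefficients of
[p], acting on absolutely summable sequences. *)
Lemma ler_norm1M (R : realType) (p q : {poly R}) :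
  norm1 (p * q) <= norm1 p * norm1 q.
Proof.
have -> : p * q = \sum_(i < size p) p`_i *: ('X^i * q).
  rewrite -{1}[p]coefK poly_def mulr_suml.
  by apply: eq_bigr => i _; rewrite scalerAl.
apply: le_trans (ler_norm1_sum _ _ _) _; rewrite mulr_suml.
by apply: ler_sum => i _; rewrite norm1Z norm1XnM.
Qed.

Lemma ler_norm1X (R : realType) (p : {poly R}) n :
  norm1 (p ^+ n) <= norm1 p ^+ n.
Proof.
elim: n => [|n IH]; first by rewrite !expr0 norm11.
by rewrite !exprS (le_trans (ler_norm1M _ _)) // ler_wpM2l ?norm1_ge0.
Qed.

Lemma norm1_Xsub1 (R : realType) : norm1 ('X - 1 : {poly R}) <= 2.
Proof. by rewrite (le_trans (ler_norm1B _ _)) // norm11 -['X]expr1 norm1Xn. Qed.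

(** Division by X - 1 replaces the coefficients by their partial sums, hence
multiplies the norm by at most the number of coefficients. *)
Lemma norm1_divXsub1 (R : realType) (p : {poly R}) :
  norm1 p <= (size p)%:R * norm1 (p * ('X - 1)).
Proof.
have coefpE i : p`_i = - \sum_(l < i.+1) (p * ('X - 1))`_l.
  elim: i => [|i IH].
    by rewrite big_ord1 mulrBr mulr1 coefB coefMX /= sub0r opprK.
  rewrite big_ord_recr /= opprD -IH mulrBr mulr1 coefB coefMX /=.
  by rewrite opprB addrCA subrr addr0.
rewrite {1}/norm1 mulr_natl -[X in _ *+ X]card_ord -sumr_const.
apply: ler_sum => i _; rewrite coefpE normrN (le_trans (ler_norm_sum _ _ _)) //.
set q := p * _; rewrite (@norm1E _ q (maxn i.+1 (size q))) ?leq_maxr //.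
rewrite (big_ord_widen (maxn i.+1 (size q)) (fun l => `|q`_l|)) ?leq_maxl //.
by rewrite big_mkcond /=; apply: ler_sum => l _; case: ifP.
Qed.

Lemma norm1_divXsub1X (R : realType) (p : {poly R}) m s : (size p <= s)%N ->
  norm1 p <= ((s + m) ^ m)%:R * norm1 (p * ('X - 1) ^+ m).
Proof.
elim: m p s => [|m IH] p s ps; first by rewrite expr0 mulr1 mul1r.
apply: (le_trans (@norm1_divXsub1 _ p)).
have sp1 : (size (p * ('X - 1))%R <= s.+1)%N.
  rewrite (leq_trans (size_polyMleq _ _)) // -polyC1 size_XsubC addn2 /=.
  by rewrite ltnS.
apply: (@le_trans _ _ (s%:R * (((s.+1 + m) ^ m)%:R *
   norm1 (p * ('X - 1) * ('X - 1) ^+ m)))).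
  by rewrite ler_pM ?norm1_ge0 ?ler_nat // IH.
rewrite -(mulrA p) -exprS mulrA -natrM ler_wpM2r ?norm1_ge0 // ler_nat.
by rewrite addSnnS expnS leq_mul2r leq_addr orbT.
Qed.

(** * The doubling relation and binary digits *)

Definition genpoly (R : realType) (mu : nat -> nat) (n : nat) : {poly R} :=
  \sum_(j < n) 'X^(mu j).

Lemma coef_genpoly (R : realType) (mu : nat -> nat) n k :
  (genpoly R mu n)`_k = #|[set j : 'I_n | mu j == k]|%:R.
Proof.
rewrite coef_sum -sum1_card natr_sum [RHS]big_mkcond /=.
apply: eq_bigr => i _; rewrite coefXn eq_sym.
have -> : (i \in [set j : 'I_n | mu j == k]) = (mu i == k).
  by apply/idP/idP => [/set_mem|h]; [|exact/mem_set].
by case: (mu i == k).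
Qed.

Lemma prZ_genpoly (R : realType) (mu : nat -> nat) n k :
  prZ R mu n k = (n%:R^-1 *: genpoly R mu n)`_k.
Proof. by rewrite /prZ coefZ coef_genpoly mulrC. Qed.

Lemma pgfZ_genpoly (R : realType) (mu : nat -> nat) n (y : R) :
  pgfZ mu n y = (n%:R^-1 *: genpoly R mu n).[y].
Proof.
rewrite /pgfZ hornerZ mulrC horner_sum.
by congr (_ * _); apply: eq_bigr => i _; rewrite hornerXn.
Qed.

Lemma doubling_prZ (R : realType) (mu : nat -> nat) n k : doubling R mu n ->
  prZ R mu (2 * n) k
  = (prZ R mu n k + (if k is k'.+1 then prZ R mu n k' else 0)) / 2.
Proof.
have half01 : 0 <= (2^-1 : R) <= 1.
  by rewrite invr_ge0 ler0n invf_le1 ?ltr0n // ler1n.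
have half2 : 1 - 2^-1 = 2^-1 :> R by field.
move=> [d [T [P [Z [I [pZ pI ZI]]]]]] /(_ k) pZI.
have pIb c : P (I @^-1` [set c]) = (2^-1)%:E.
  have := congr1 (fun f => f [set c]) pI.
  rewrite /distribution /pushforward /bernoulli_prob half01 fsbig_set1 => ->.
  by case: c => //=; rewrite half2.
have mZ l : measurable (Z @^-1` [set l]) by exact: measurable_funPTI.
have mI c : measurable (I @^-1` [set c]) by exact: measurable_funPTI.
have PZI l c : P (Z @^-1` [set l] `&` I @^-1` [set c])
    = (prZ R mu n l / 2)%:E.
  by rewrite ZI // pZ pIb -EFinM.
apply: EFin_inj; rewrite -pZI.
have -> : (fun w => (Z w + I w)%N) @^-1` [set k]
    = (Z @^-1` [set k] `&` I @^-1` [set false])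
    `|` (if k is k'.+1 then Z @^-1` [set k'] `&` I @^-1` [set true] else set0).
  apply/seteqP; split => [w|w] /=.
    move=> <-; case Iw : (I w); last by left; rewrite addn0.
    by right; rewrite addn1 /= Iw.
  case=> [[<- ->]|]; first by rewrite addn0.
  by case: (k) => [//|k'] [<- ->]; rewrite addn1.
rewrite measureU; last 3 first.
- exact: measurableI.
- by case: (k) => [|k']; [exact: measurable0|exact: measurableI].
- apply/seteqP; split => // w [[_ /= Iw]].
  by case: (k) => [//|k'] [_ /=]; rewrite Iw.
case: (k) => [|k']; first by rewrite measure0 adde0 addr0; exact: PZI.
by rewrite mulrDl EFinD; congr (_ + _)%E; exact: PZI.
Qed.

Lemma genpoly_double (R : realType) (mu : nat -> nat) n : (1 <= n)%N ->
  doubling R mu n -> genpoly R mu (2 * n) = (1 + 'X) * genpoly R mu n.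
Proof.
move=> n1 Hd; have n0 : n%:R != 0 :> R by rewrite pnatr_eq0 -lt0n.
have n20 : (2 * n)%:R != 0 :> R by rewrite pnatr_eq0 -lt0n muln_gt0.
apply: (scalerI (invr_neq0 n20)); apply/polyP => k.
rewrite -prZ_genpoly doubling_prZ // !prZ_genpoly (mulrDl 1 'X) mul1r.
rewrite natrM invfM -scalerA !coefZ coefD coefXM.
case: k => [|k]; last by rewrite prZ_genpoly coefZ /=; field.
by rewrite /= !addr0; field.
Qed.

(** Doubling forces [genpoly mu (2 ^ a) = (1 + 'X) ^+ a], whose degree bounds
the values of [mu] below [2 ^ a]. *)
Lemma mu_le_exponent (R : realType) (mu : nat -> nat) :
  mu 0%N = 0%N ->
  (forall n, (1 <= n)%N -> genpoly R mu (2 * n) = (1 + 'X) * genpoly R mu n) ->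
  forall a j, (j < 2 ^ a)%N -> (mu j <= a)%N.
Proof.
move=> mu0 Hd a j ja.
have E : genpoly R mu (2 ^ a) = (1 + 'X) ^+ a.
  elim: {j ja} a => [|a IH].
    by rewrite /genpoly big_ord1 mu0 !expr0.
  by rewrite expnS Hd ?expn_gt0 // IH exprS.
have sz : size ((1 + 'X : {poly R}) ^+ a) = a.+1.
  rewrite addrC -[1](opprK) -polyC1 -polyCN size_exp_XsubC //.
rewrite -ltnS -sz ltnNge; apply/negP => /(nth_default 0).
rewrite -E coef_genpoly => /eqP; rewrite pnatr_eq0 => /eqP/card0_eq.
by move=> /(_ (Ordinal ja)); rewrite mem_set //= eqxx.
Qed.

Lemma trunc_log2_double (n : nat) (d : bool) : (1 <= n)%N ->
  trunc_log 2 (2 * n + d) = (trunc_log 2 n).+1.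
Proof.
move=> n1; apply: trunc_log_eq => //.
have /andP[h1 h2] := trunc_log_bounds (isT : (1 < 2)%N) n1.
rewrite (expnS _ (trunc_log 2 n)) (expnS _ (trunc_log 2 n).+1).
by case: d => /=; lia.
Qed.

(** Cutting [[0, n)] along the binary digits of [n] gives blocks of lengths
[2 ^ (lambda n - j)], one for each digit 1, in each of which [mu] is
distributed as a shifted binomial variable. *)
Lemma genpoly_digits (R : realType) (mu : nat -> nat) :
  mu 0%N = 0%N ->
  (forall n, (1 <= n)%N -> genpoly R mu (2 * n) = (1 + 'X) * genpoly R mu n) ->
  forall n, (1 <= n)%N -> exists (e : nat -> bool) (c : nat -> nat),
    (forall j, (c j <= j.+1)%N) /\
    genpoly R mu n = \sum_(j < (lambda n).+1)
      (e j)%:R *: ((1 + 'X) ^+ (lambda n - j) * 'X^(c j)).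
Proof.
move=> mu0 Hd n; elim/ltn_ind: n => n IH n1.
have [->|n2] := eqVneq n 1%N.
  exists (fun => true), (fun => 0%N); split => //.
  by rewrite /lambda trunc_log1 /genpoly !big_ord1 mu0 expr0 mul1r scale1r.
pose n' := n./2; pose d := odd n.
have nE : n = (2 * n' + d)%N by rewrite -[LHS]odd_double_half -mul2n addnC.
have n'1 : (1 <= n')%N by move: n1 n2 nE; case: (d) => /=; lia.
have [e [c [cj Sn']]] := IH n' ltac:(lia) n'1.
have lamE : lambda n = (lambda n').+1.
  by rewrite [in LHS]nE /lambda trunc_log2_double.
(* The digit [d] comes last; the [minn] has no effect at the index
   [lambda n], and makes the bound on [c] hold for all indices. *)
exists (fun j => if (j <= lambda n')%N then e j else d).
exists (fun j => if (j <= lambda n')%N then c j else minn (mu (2 * n')) j.+1).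
split; first by move=> j; case: ifP => // _; exact: geq_minr.
have Sn : genpoly R mu n
    = (1 + 'X) * genpoly R mu n' + d%:R *: 'X^(mu (2 * n')).
  rewrite -Hd // [in LHS]nE; case: (d) => /=; last first.
    by rewrite addn0 scale0r addr0.
  by rewrite addn1 /genpoly big_ord_recr /= scale1r.
rewrite Sn lamE big_ord_recr /= ltnn subnn expr0 mul1r; congr (_ + _).
  rewrite Sn' mulr_sumr; apply: eq_bigr => i _.
  by rewrite -ltnS ltn_ord -scalerAr mulrA -exprS subSn // -ltnS.
congr (_ *: 'X^_); symmetry; apply/minn_idPl.
apply: (leq_trans (mu_le_exponent mu0 Hd (a := (lambda n').+2) _)) => //.
have := trunc_log_ltn n' (isT : (1 < 2)%N).
by rewrite -/(lambda n') => ?; rewrite expnS; lia.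
Qed.

(** * Polynomial growth *)

(** This is [1 + t <= expR t] at [t = a * x / p], raised to the power [p]. *)
Lemma pow_le_expR (R : realType) (p : nat) (a : R) : 0 < a ->
  exists2 C, 0 <= C & forall x, 0 <= x -> (1 + x) ^+ p <= C * expR (a * x).
Proof.
move=> a0; case: p => [|p].
  exists 1 => // x x0; rewrite expr0 mul1r -expR0 ler_expR.
  by rewrite mulr_ge0 // ltW.
have p0 : 0 < p.+1%:R :> R by rewrite ltr0n.
exists ((1 + p.+1%:R / a) ^+ p.+1) => [|x x0].
  by rewrite exprn_ge0 // addr_ge0 // divr_ge0 // ltW.
have -> : expR (a * x) = expR (a * x / p.+1%:R) ^+ p.+1.
  by rewrite -expRM_natl [in RHS]mulrC divfK // gt_eqF.
rewrite -exprMn lerXn2r ?nnegrE ?addr_ge0 //.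
  by rewrite mulr_ge0 ?expR_ge0 // addr_ge0 // divr_ge0 // ltW.
apply: (@le_trans _ _ ((1 + p.+1%:R / a) * (1 + a * x / p.+1%:R))); last first.
  by rewrite ler_wpM2l ?expR_ge1Dx // addr_ge0 // divr_ge0 // ltW.
have -> : (1 + p.+1%:R / a) * (1 + a * x / p.+1%:R)
    = 1 + x + (p.+1%:R / a + a * x / p.+1%:R).
  by field; rewrite !gt_eqF.
by rewrite lerDl addr_ge0 // ?divr_ge0 // ?mulr_ge0 // ltW.
Qed.

Lemma sum_pow_geometric (R : realType) (p : nat) :
  exists2 C : R, 0 <= C &
    forall K, \sum_(j < K) j.+1%:R ^+ p * 2 ^- j <= C.
Proof.
have a0 : 0 < 4^-1 :> R by rewrite invr_gt0.
have [C C0 HC] := pow_le_expR p a0.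
exists (C * 3) => [|K]; first by rewrite mulr_ge0.
(* [j.+1 ^+ p] grows at most like [(4 / 3) ^+ j], which [2 ^- j] turns into a
   geometric sum of ratio [2 / 3]. *)
have e43 : expR 4^-1 <= 4 / 3 :> R.
  have := expR_ge1Dx (- 4^-1 : R); rewrite expRN.
  have -> : 1 - 4^-1 = (4 / 3)^-1 :> R by field.
  by rewrite lef_pV2 // posrE ?expR_gt0 // divr_gt0.
have geo : \sum_(j < K) (2 / 3 : R) ^+ j <= 3.
  have -> : \sum_(j < K) (2 / 3 : R) ^+ j = 3 * (1 - (2 / 3) ^+ K).
    elim: K => [|K IH]; first by rewrite big_ord0 expr0 subrr mulr0.
    by rewrite big_ord_recr IH /= exprS; field.
  by rewrite ler_piMr // lerBlDr lerDl exprn_ge0 // divr_ge0.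
apply: le_trans (ler_wpM2l C0 geo); rewrite mulr_sumr.
apply: ler_sum => j _.
have -> : (2 / 3 : R) ^+ j = (4 / 3) ^+ j * 2 ^- j.
  by rewrite -exprVn -exprMn; congr (_ ^+ _); field.
rewrite mulrA ler_wpM2r ?invr_ge0 ?exprn_ge0 //.
rewrite -natr1 addrC (le_trans (HC _ _)) ?ler0n //.
by rewrite ler_wpM2l // mulrC expRM_natl lerXn2r ?nnegrE ?expR_ge0 ?divr_ge0.
Qed.

(** * Taylor expansion of one digit block *)

Definition binpoly (R : realType) (N : nat) : {poly R} :=
  (2^-1 *: (1 + 'X)) ^+ N.

Lemma norm1_binpoly (R : realType) N : norm1 (binpoly R N) <= 1.
Proof.
rewrite (le_trans (ler_norm1X _ _)) // exprn_ile1 ?norm1_ge0 // norm1Z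
  ger0_norm ?invr_ge0 // ler_pdivrMl // mulr1.
by rewrite (le_trans (ler_norm1D _ _)) // norm11 -['X]expr1 norm1Xn.
Qed.

Lemma binpolyD (R : realType) M N :
  binpoly R (M + N) = binpoly R M * binpoly R N.
Proof. exact: exprD. Qed.

Lemma size_binpoly (R : realType) N : (size (binpoly R N) <= N.+1)%N.
Proof.
apply: (leq_trans (size_poly_exp_leq _ _)).
rewrite size_scale ?invr_eq0 ?pnatr_eq0 // addrC -polyC1 size_XaddC /=.
by rewrite mul1n.
Qed.

(** The binomial theorem bounds the sum of the powers [k ^ (r - i)] by
[(k + 1) ^ r]. *)
Lemma coef_pow_boundM (R : realType) (k : nat) (p q : {poly R}) :
  (forall r, `|p`_r| <= k%:R ^+ r) -> (forall r, `|q`_r| <= 1) ->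
  forall r, `|(p * q)`_r| <= k.+1%:R ^+ r.
Proof.
move=> hp hq r; rewrite coefMr -natr1 exprDn.
rewrite (le_trans (ler_norm_sum _ _ _)) //; apply: ler_sum => i _.
rewrite expr1n mulr1 normrM (@le_trans _ _ (k%:R ^+ (r - i))) //.
  by rewrite -[leRHS]mulr1 ler_pM.
rewrite -[leLHS]mulr1n ler_wpMn2l ?exprn_ge0 //.
by rewrite bin_gt0 -ltnS.
Qed.

Lemma coef_pow_boundMX (R : realType) (k n : nat) (p q : {poly R}) :
  (forall r, `|p`_r| <= k%:R ^+ r) -> (forall r, `|q`_r| <= 1) ->
  forall r, `|(p * q ^+ n)`_r| <= (k + n)%:R ^+ r.
Proof.
move=> hp hq; elim: n => [|n IH] r; first by rewrite expr0 mulr1 addn0.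
by rewrite exprSr mulrA addnS; apply: coef_pow_boundM.
Qed.

Lemma binpoly_comp (R : realType) j :
  ((1 + 2^-1 *: 'X) ^+ j) \Po ('X - 1) = binpoly R j.
Proof.
rewrite rmorphXn /= /binpoly; congr (_ ^+ _).
rewrite rmorphD rmorph1 /= linearZ /= comp_polyX !scalerDr scalerN.
rewrite addrCA [RHS]addrC; congr (_ + _).
apply/eqP; rewrite subr_eq -scalerDl.
rewrite (_ : 2^-1 + 2^-1 = 1 :> R); last by field.
by rewrite scale1r.
Qed.

(** The geometric series of [1 / (1 + X / 2)], truncated. *)
Definition inv1Xhalf (R : realType) (m : nat) : {poly R} :=
  \sum_(i < m.+1) (- 2^-1 *: 'X) ^+ i.

Lemma inv1XhalfP (R : realType) (m : nat) :
  (1 + 2^-1 *: 'X) * inv1Xhalf R m = 1 - (- 2^-1) ^+ m.+1 *: 'X^(m.+1).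
Proof.
rewrite /inv1Xhalf -exprZn -[RHS]opprB subrX1 -mulNr opprB.
by rewrite scaleNr opprK.
Qed.

Lemma coef_inv1Xhalf (R : realType) (m r : nat) : `|(inv1Xhalf R m)`_r| <= 1.
Proof.
have -> : inv1Xhalf R m = \poly_(i < m.+1) (- 2^-1) ^+ i.
  by rewrite poly_def; apply: eq_bigr => i _; rewrite exprZn.
rewrite coef_poly; case: ifP; rewrite ?normr0 // normrX normrN => _.
by rewrite exprn_ile1 // ger0_norm ?invr_ge0 // invf_le1 ?ler1n.
Qed.

(** With [u = X - 1], the polynomial [A] is the truncation of the series
[(1 + u)^c (1 + u / 2)^(-j)]. A product of [c + j] series with coefficients at
most 1 in absolute value has r-th coefficient at most [(c + j)^r], which makes
all the bounds polynomial in [j]; those on [Q] follow by dividing repeatedly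
by [X - 1]. *)
Lemma taylor_quotient (R : realType) (m : nat) :
  exists2 C : R, 0 <= C & forall j c, (c <= j.+1)%N ->
  exists A Q : {poly R},
  [/\ (size A <= m.+1)%N,
      (forall r, `|A`_r| <= C * j.+1%:R ^+ m),
      'X^c - binpoly R j * (A \Po ('X - 1)) = Q * ('X - 1) ^+ m.+1 &
      norm1 Q <= C * j.+1%:R ^+ (m + m.+1)].
Proof.
pose C : R := (2 ^ m)%:R.
have C1 : 1 <= C by rewrite ler1n expn_gt0.
pose C' : R := ((m + 3) ^ m.+1)%:R * (1 + m.+1%:R * C * C).
have CC' : C <= C'.
  rewrite /C' -[leLHS]mul1r ler_pM ?ler1n ?expn_gt0 ?addn_gt0 ?orbT //.
  rewrite -[leLHS]add0r lerD // -[leLHS]mul1r ler_wpM2r ?(le_trans ler01) //.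
  by rewrite mulr_ege1 // ler1n.
exists C'; first exact: le_trans (le_trans ler01 C1) CC'.
move=> j c cj.
pose full : {poly R} := (1 + 'X) ^+ c * inv1Xhalf R m ^+ j.
have hfull r : `|full`_r| <= (c + j)%:R ^+ r.
  apply: coef_pow_boundMX; last exact: coef_inv1Xhalf.
  move=> {}r; rewrite -[X in X%:R]add0n -[_ ^+ c]mul1r.
  apply: coef_pow_boundMX => k.
    by rewrite coef1; case: k => [|k] /=; rewrite ?normr1 ?normr0 ?expr0
      ?exprn_ge0.
  rewrite coefD coef1 coefX; case: k => [|[|k]] /=;
    by rewrite ?addr0 ?add0r ?normr1 ?normr0.
pose A := take_poly m.+1 full.
have Abnd r : `|A`_r| <= C * j.+1%:R ^+ m.
  rewrite /A coef_take_poly; case: ifP => [rm|_]; last first.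
    by rewrite normr0 mulr_ge0 ?exprn_ge0 // (le_trans ler01).
  rewrite (le_trans (hfull r)) // /C natrX -exprMn -natrM.
  apply: (@le_trans _ _ ((2 * j.+1)%:R ^+ r)).
    by rewrite lerXn2r ?nnegrE // ler_nat; lia.
  by rewrite ler_weXn2l // ler1n muln_gt0.
pose D := drop_poly m.+1 full.
pose z : {poly R} := (- 2^-1) ^+ m.+1 *: 'X^(m.+1).
have [G GE] : exists G, 1 - (1 - z) ^+ j = z * G.
  exists (\sum_(i < j) (1 - z) ^+ i).
  by rewrite -opprB subrX1 -mulNr !opprB addrCA subrr addr0.
pose Q0 := (1 + 'X) ^+ c * ((- 2^-1) ^+ m.+1 *: G) + (1 + 2^-1 *: 'X) ^+ j * D.
have Q0E : (1 + 'X) ^+ c - (1 + 2^-1 *: 'X) ^+ j * A = Q0 * 'X^(m.+1).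
  have -> : A = full - D * 'X^(m.+1).
    by rewrite -[full](poly_take_drop m.+1) addrK.
  rewrite mulrBr opprB addrCA addrC /Q0 mulrDl.
  congr (_ + _); last by rewrite mulrA.
  rewrite /full mulrCA -exprMn inv1XhalfP -/z -{1}[(1 + 'X) ^+ c]mulr1 -mulrBr.
  by rewrite GE -mulrA; congr (_ * _); rewrite /z -!scalerAl mulrC.
pose Q := Q0 \Po ('X - 1).
have QE : 'X^c - binpoly R j * (A \Po ('X - 1)) = Q * ('X - 1) ^+ m.+1.
  have := congr1 (fun p => p \Po ('X - 1)) Q0E.
  rewrite rmorphB !rmorphM /= binpoly_comp !rmorphXn /= rmorphD rmorph1 /=.
  by rewrite comp_polyX (addrC 1 ('X - 1)) subrK.
have sA : (size A <= m.+1)%N by exact: size_take_poly.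
exists A, Q; split => //.
  by move=> r; rewrite (le_trans (Abnd r)) // ler_wpM2r ?exprn_ge0.
have nA : norm1 (A \Po ('X - 1)) <= m.+1%:R * C * C * j.+1%:R ^+ m.
  rewrite comp_polyE (le_trans (ler_norm1_sum _ _ _)) //.
  rewrite (@le_trans _ _ (\sum_(i < size A) C * j.+1%:R ^+ m * C)) //.
    apply: ler_sum => i _; rewrite norm1Z ler_pM ?norm1_ge0 //.
    apply: (le_trans (ler_norm1X _ _)).
    apply: (@le_trans _ _ (2 ^+ i)).
      by rewrite lerXn2r ?nnegrE ?norm1_ge0 ?norm1_Xsub1.
    rewrite /C natrX ler_weXn2l ?ler1n //.
    by rewrite -ltnS (leq_trans (ltn_ord i)).
  rewrite sumr_const card_ord -[leLHS]mulr_natl.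
  rewrite (_ : m.+1%:R * C * C * _ = m.+1%:R * (C * j.+1%:R ^+ m * C)).
    by rewrite ler_wpM2r ?mulr_ge0 ?exprn_ge0 // ler_nat.
  by rewrite -!mulrA (mulrC C (_ ^+ _)).
have sQ : (size Q <= j.+2)%N.
  have [->|Qn0] := eqVneq Q 0; first by rewrite size_poly0.
  have := congr1 (fun p : {poly R} => size p) QE.
  rewrite -polyC1 size_Mmonic ?monic_exp ?monicXsubC // size_exp_XsubC addnS /=.
  move=> sE; have : (size Q + m.+1 <= j.+2 + m.+1)%N; last by rewrite leq_add2r.
  rewrite -sE (leq_trans (size_polyD _ _)) // geq_max size_polyXn size_polyN.
  apply/andP; split; first by lia.
  rewrite (leq_trans (size_polyMleq _ _)) //.
  have := size_comp_poly_leq A ('X - 1%:P); rewrite size_XsubC /= muln1.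
  move: (size_binpoly R j) sA.
  by move: (size _) (size _) (size _) => a b d; lia.
apply: (le_trans (norm1_divXsub1X m.+1 sQ)); rewrite -QE.
have nL : norm1 ('X^c - binpoly R j * (A \Po ('X - 1)))
    <= (1 + m.+1%:R * C * C) * j.+1%:R ^+ m.
  rewrite (le_trans (ler_norm1B _ _)) // norm1Xn mulrDl mul1r lerD //.
    by rewrite exprn_ege1 // ler1n.
  rewrite (le_trans (ler_norm1M _ _)) // -[leRHS]mul1r.
  by rewrite ler_pM ?norm1_ge0 ?norm1_binpoly.
rewrite exprD (mulrC (_ ^+ m)) /C' mulrACA.
apply: ler_pM; rewrite ?norm1_ge0 //.
by rewrite natrX natrX -exprMn lerXn2r ?nnegrE // -natrM ler_nat; lia.
Qed.

(** * Krawtchouk and Hermite polynomials *)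

(** The probabilists' Hermite polynomials, by the recurrence that
differentiating [P * exp (- x^2 / 2)] suggests. *)
Fixpoint hermp (R : realType) (m : nat) : {poly R} :=
  if m is m'.+1 then 'X * hermp R m' - (hermp R m')^`() else 1.

Lemma deriv_hermp (R : realType) m :
  (hermp R m)^`() = m%:R *: hermp R m.-1.
Proof.
elim: m => [|m IH]; first by rewrite /= -polyC1 derivC scale0r.
have -> : (hermp R m.+1)^`() = hermp R m + ('X * (hermp R m)^`()
    - ((hermp R m)^`())^`()) by rewrite /= derivB derivM derivX mul1r addrA.
rewrite IH derivZ -scalerAr -scalerBr /= -natr1 scalerDl scale1r addrC.
by case: m {IH} => [|m]; rewrite ?scale0r.
Qed.

Lemma hermpS (R : realType) m :
  hermp R m.+1 = 'X * hermp R m - m%:R *: hermp R m.-1.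
Proof. by rewrite -deriv_hermp. Qed.

(** The coefficients are the m-th differences of the binomial coefficients of
order [M - m], and at the same time the binomial coefficients of order [M]
times normalized Krawtchouk polynomials. The limit is visible in the second
description, provided that [M] rather than [M - m] is held fixed when [m]
varies. *)
Definition krawp (R : realType) (M m : nat) : {poly R} :=
  (1 - 'X) ^+ m * (1 + 'X) ^+ (M - m).

(** Multiplying the k-th coefficient by [M - 2 k] is the operator
[P -> M P - 2 X P'], and this operator maps [krawp R M m] to a combination of
its two neighbours; on coefficients this is the three-term recurrence of the
Krawtchouk polynomials. *)
Lemma krawp_rec (R : realType) M m : (m < M)%N ->
  (M%:R - m%:R) *: krawp R M m.+1 + m%:R *: krawp R M m.-1
  = M%:R *: krawp R M m - 2 *: ('X * (krawp R M m)^`()).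
Proof.
move=> mM; rewrite /krawp -natrB ?(ltnW mM) // !scaler_nat.
have dm n : ((1 - 'X : {poly R}) ^+ n)^`() = - ((1 - 'X) ^+ n.-1 *+ n).
  rewrite deriv_exp derivB derivX -polyC1 derivC sub0r mulN1r.
  by rewrite mulNrn.
have dp n : ((1 + 'X : {poly R}) ^+ n)^`() = (1 + 'X) ^+ n.-1 *+ n.
  by rewrite deriv_exp derivD derivX -polyC1 derivC add0r mul1r.
set N := (M - m.+1)%N.
have -> : (M - m = N.+1)%N by rewrite subnSK.
have ME : M = (m + N.+1)%N by rewrite /N; lia.
rewrite derivM dm dp /= ME.
case: m mM N {ME} => [|m] mM N /=.
  by rewrite subn0 !expr0 !exprS; move: (_ ^+ N) => b; ring.
have -> : (m.+1 + N.+1 - m = N.+2)%N by lia.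
rewrite !exprS; move: (_ ^+ N) (_ ^+ m) => b a; ring.
Qed.

Lemma krawp_coef_rec (R : realType) M m k : (m < M)%N ->
  (M%:R - m%:R) * (krawp R M m.+1)`_k + m%:R * (krawp R M m.-1)`_k
  = (M%:R - 2 * k%:R) * (krawp R M m)`_k.
Proof.
move=> /(krawp_rec R) /(congr1 (fun p : {poly R} => p`_k)) /=.
rewrite !(coefD, coefN, coefZ) => ->; rewrite mulrBl -mulrA; congr (_ - 2 * _).
by rewrite coefXM; case: k => [|k] /=; rewrite ?mul0r // coef_deriv mulr_natl.
Qed.

(** The recurrence differs from that of [hermp] only by the factor [1 - j / M]
of its leading term, so that each step adds an error of order [1 / M]. *)
Lemma krawtchouk_hermite (R : realType) (m i : nat) :
  exists2 C : R, 0 <= C & forall (M : nat) (x : R) (r : nat -> R),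
  (1 <= M)%N -> (m <= M)%N -> r 0%N = 1 ->
  (forall j, (j < m)%N ->
     (1 - j%:R / M%:R) * r j.+1 = x * r j - j%:R * r j.-1) ->
  (i <= m)%N ->
  `|r i| <= C * (1 + `|x|) ^+ i /\
  `|r i - (hermp R i).[x]| <= C * (1 + `|x|) ^+ i / M%:R.
Proof.
elim/ltn_ind: i => -[_|i IH].
  exists 1 => // M x r M1 mM r0 _ _; rewrite r0 /= hornerC subrr normr0 normr1.
  by rewrite expr0 mulr1; split=> //; rewrite divr_ge0.
have [C1 C10 H1] := IH i (ltnSn i).
have [C2 C20 H2] := IH i.-1 (leq_ltn_trans (leq_pred i) (ltnSn i)).
pose C3 := C1 + i%:R * C2; pose C4 := m%:R * C3.
have C30 : 0 <= C3 by rewrite addr_ge0 ?mulr_ge0.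
have C40 : 0 <= C4 by rewrite mulr_ge0.
exists (C4 + (C3 + i%:R * C4)) => [|M x r M1 mM r0 rec im].
  by rewrite !addr_ge0 ?mulr_ge0.
have [h1 h1'] := H1 M x r M1 mM r0 rec (ltnW im).
have [h2 h2'] := H2 M x r M1 mM r0 rec (leq_trans (leq_pred i) (ltnW im)).
set A := 1 + `|x| in h1 h2 h1' h2' *.
have A1 : 1 <= A by rewrite lerDl.
have xA : `|x| <= A by rewrite lerDr.
have M0 : 0 < M%:R :> R by rewrite ltr0n.
have m0 : 0 < m%:R :> R by rewrite ltr0n (leq_trans _ im).
have comb u v e : 0 <= e ->
    `|u| <= C1 * A ^+ i * e -> `|v| <= C2 * A ^+ i.-1 * e ->
    `|x * u - i%:R * v| <= C3 * A ^+ i.+1 * e.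
  move=> e0 hu hv; rewrite (le_trans (ler_normB _ _)) // !normrM normr_nat.
  rewrite /C3 !mulrDl lerD //.
    rewrite exprS (_ : C1 * (A * A ^+ i) * e = A * (C1 * A ^+ i * e)).
      by rewrite ler_pM.
    by ring.
  rewrite -!mulrA ler_wpM2l // (le_trans hv) // -mulrA ler_wpM2l //.
  by rewrite ler_wpM2r // ler_weXn2l // (leq_trans (leq_pred i)).
(* [i < m <= M], so the divisor stays away from 0 uniformly in [M]. *)
have q0 : m%:R^-1 <= 1 - i%:R / M%:R :> R.
  rewrite -(ler_pM2l M0) mulrBr mulr1 mulrCA divff ?gt_eqF // mulr1.
  rewrite -(ler_pM2l m0) mulrCA divff ?gt_eqF // mulr1 -natrB ?(leq_trans _
    mM) 1?ltnW //.
  rewrite -natrM ler_nat.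
  by move: im mM M1; clear; nia.
have rS : r i.+1 = (x * r i - i%:R * r i.-1) / (1 - i%:R / M%:R).
  by rewrite -rec // mulrC mulKf // gt_eqF // (lt_le_trans _ q0) ?invr_gt0.
have h3 : `|r i.+1| <= C4 * A ^+ i.+1.
  rewrite rS normrM normfV (ger0_norm (le_trans _ q0)) ?invr_ge0 //.
  rewrite ler_pdivrMr ?(lt_le_trans _ q0) ?invr_gt0 //.
  apply: (@le_trans _ _ (C3 * A ^+ i.+1 * 1)).
    by apply: comb; rewrite ?mulr1.
  have -> : C4 * A ^+ i.+1 * (1 - i%:R / M%:R)
      = C3 * A ^+ i.+1 * (m%:R * (1 - i%:R / M%:R)) by rewrite /C4; ring.
  rewrite ler_wpM2l ?mulr_ge0 ?exprn_ge0 ?(le_trans ler01 A1) //.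
  by rewrite -ler_pdivrMl // mulr1.
have A0 : 0 <= A ^+ i.+1 by rewrite exprn_ge0 // (le_trans ler01).
split.
  by rewrite (le_trans h3) // ler_wpM2r // lerDl addr_ge0 ?mulr_ge0.
have -> : r i.+1 - (hermp R i.+1).[x]
    = (x * (r i - (hermp R i).[x]) - i%:R * (r i.-1 - (hermp R i.-1).[x]))
      + i%:R / M%:R * r i.+1.
  rewrite hermpS hornerD hornerN hornerZ hornerM hornerX.
  transitivity ((1 - i%:R / M%:R) * r i.+1 + i%:R / M%:R * r i.+1
    - (x * (hermp R i).[x] - i%:R * (hermp R i.-1).[x])); first by ring.
  by rewrite rec //; ring.
rewrite (le_trans (ler_normD _ _)) //.
have -> : (C4 + (C3 + i%:R * C4)) * A ^+ i.+1 / M%:R = C3 * A ^+ i.+1 * M%:R^-1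
   + (i%:R / M%:R * (C4 * A ^+ i.+1) + C4 * A ^+ i.+1 / M%:R) by ring.
rewrite lerD //; first by apply: comb; rewrite ?invr_ge0.
rewrite normrM ger0_norm ?divr_ge0 // -[leLHS]addr0 lerD //.
  by rewrite ler_wpM2l // divr_ge0.
by rewrite divr_ge0 // mulr_ge0.
Qed.

(** * Moments of the standardized binomial law *)

Definition binw (R : realType) (M k : nat) : R := 'C(M, k)%:R * 2 ^- M.

(** [binx] is standardized to mean 0 and variance 1, and decreases with [k]:
with this sign, the recurrence of [krawp] tends to that of [hermp] without
alternating signs. *)
Definition binx (R : realType) (M k : nat) : R :=
  (M%:R - 2 * k%:R) / Num.sqrt M%:R.

Lemma binw_ge0 (R : realType) M k : 0 <= binw R M k.
Proof. by rewrite mulr_ge0 // invr_ge0 exprn_ge0. Qed.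

Lemma sqrt_nat_gt0 (R : realType) M : (1 <= M)%N -> 0 < Num.sqrt (M%:R : R).
Proof. by move=> M1; rewrite sqrtr_gt0 ltr0n. Qed.

Lemma sqr_sqrt_nat (R : realType) M : Num.sqrt (M%:R : R) ^+ 2 = M%:R.
Proof. exact: sqr_sqrtr. Qed.

Lemma coef_1addXn (R : realType) M k :
  ((1 + 'X : {poly R}) ^+ M)`_k = 'C(M, k)%:R.
Proof.
elim: M k => [|M IH] k; first by rewrite expr0 coef1 bin0n.
rewrite exprS mulrDl mul1r coefD coefXM !IH.
by case: k => [|k] /=; rewrite ?bin0 ?addr0 // binS natrD.
Qed.

(** Both estimates are relative to ['C(M, k)], so that summing them over [k]
only takes moments of the binomial law. *)
Lemma krawp_hermite (R : realType) m :
  exists2 C : R, 0 <= C & forall M k, (1 <= M)%N -> (m <= M)%N -> (k <= M)%N ->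
  `|Num.sqrt M%:R ^+ m * (krawp R M m)`_k|
     <= 'C(M, k)%:R * (C * (1 + `|binx R M k|) ^+ m) /\
  `|Num.sqrt M%:R ^+ m * (krawp R M m)`_k
      - 'C(M, k)%:R * (hermp R m).[binx R M k]|
     <= 'C(M, k)%:R * (C * (1 + `|binx R M k|) ^+ m / M%:R).
Proof.
have [C C0 H] := krawtchouk_hermite R m m; exists C => // M k M1 mM kM.
have s0 := sqrt_nat_gt0 R M1; have ss := sqr_sqrt_nat R M.
set s := Num.sqrt _ in s0 ss *.
have c0 : 0 < 'C(M, k)%:R :> R by rewrite ltr0n bin_gt0.
pose r j := s ^+ j * (krawp R M j)`_k / 'C(M, k)%:R.
have r0 : r 0%N = 1.
  rewrite /r /krawp !expr0 !mul1r subn0.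
  by rewrite coef_1addXn divff // gt_eqF.
have rrec j : (j < m)%N ->
    (1 - j%:R / M%:R) * r j.+1 = binx R M k * r j - j%:R * r j.-1.
  move=> jm; have jM := leq_trans jm mM.
  have /(canRL (addrK _)) E := krawp_coef_rec R k jM.
  have -> : (1 - j%:R / M%:R) * r j.+1
      = s ^+ j.+1 / M%:R * ((M%:R - j%:R) * (krawp R M j.+1)`_k) / 'C(M, k)%:R.
    by rewrite /r; field; rewrite ?gt_eqF // ltr0n.
  rewrite E /r /binx -/s -ss.
  case: j {E jm jM} => [|j] /=.
    by rewrite !mul0r !subr0; field; rewrite !gt_eqF.
  by rewrite !exprS; field; rewrite !gt_eqF.
have [h1 h2] := H M (binx R M k) r M1 mM r0 rrec (leqnn m).
have rE : s ^+ m * (krawp R M m)`_k = 'C(M, k)%:R * r m.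
  by rewrite /r [RHS]mulrC divfK // gt_eqF.
rewrite rE -mulrBr (normrM _ (r m)) (normrM _ (r m - _)) normr_nat.
by split; rewrite ler_wpM2l.
Qed.

Lemma expR_le_quadratic (R : realType) (t : R) : `|t| <= 2^-1 ->
  expR t <= 1 + t + 2 * t ^+ 2.
Proof.
rewrite ler_norml => /andP[t1 t2].
have h0 : 0 < 1 - t by lra.
have h : expR t <= (1 - t)^-1.
  rewrite -[expR t]invrK lef_pV2 ?posrE ?invr_gt0 ?expR_gt0 // -expRN.
  exact: expR_ge1Dx.
apply: le_trans h _; rewrite -[leLHS]mul1r ler_pdivrMr //.
have -> : (1 + t + 2 * t ^+ 2) * (1 - t) = 1 + t ^+ 2 * (1 - 2 * t) by ring.
by rewrite lerDl mulr_ge0 ?sqr_ge0 //; lra.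
Qed.

(** The left-hand side is the M-th power of [cosh t]. *)
Lemma binw_exp_moment (R : realType) (M : nat) (t : R) : `|t| <= 2^-1 ->
  \sum_(k < M.+1) binw R M k * expR ((M%:R - 2 * k%:R) * t)
  <= expR (M%:R * (2 * t ^+ 2)).
Proof.
move=> t2.
have -> : \sum_(k < M.+1) binw R M k * expR ((M%:R - 2 * k%:R) * t)
    = ((expR t + expR (- t)) / 2) ^+ M.
  rewrite exprMn exprVn exprDn mulr_suml; apply: eq_bigr => k _.
  rewrite -!expRM_natl -expRD -[X in _ = X * _]mulr_natl /binw mulrAC.
  have kM : (k <= M)%N by rewrite -ltnS.
  by rewrite natrB //; congr (_ * expR _ * _); ring.
rewrite expRM_natl lerXn2r ?nnegrE ?expR_ge0 ?divr_ge0 ?addr_ge0 ?expR_ge0 //.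
apply: le_trans (expR_ge1Dx _).
have := expR_le_quadratic t2.
have := @expR_le_quadratic _ (- t); rewrite normrN => /(_ t2).
by rewrite sqrrN ler_pdivrMr //; lra.
Qed.

(** Exponential moments of the standardized binomial law are bounded, whence
all the absolute moments, uniformly in the number of coins. *)
Lemma binw_moment (R : realType) (p : nat) :
  exists2 C : R, 0 <= C & forall M, (1 <= M)%N ->
  \sum_(k < M.+1) binw R M k * (1 + `|binx R M k|) ^+ p <= C.
Proof.
have [C C0 H] := pow_le_expR p (a := (2^-1 : R)) ltac:(by rewrite invr_gt0).
exists (C * (expR 2^-1 + expR 2^-1)) => [|M M1].
  by rewrite mulr_ge0 // addr_ge0 // expR_ge0.
have s0 := sqrt_nat_gt0 R M1; have ss := sqr_sqrt_nat R M.
set s := Num.sqrt _ in s0 ss *.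
(* Half of [binx] is used as exponent, so that [t] is at most [1 / 2] for
   every [M]. *)
pose t := (2 * s)^-1.
have t0 : 0 <= t by rewrite invr_ge0 mulr_ge0 // ltW.
have s1 : 1 <= s by rewrite -sqrtr1 ler_sqrt ?ler1n // ltr0n.
have t2 : `|t| <= 2^-1.
  by rewrite ger0_norm // lef_pV2 ?posrE ?mulr_gt0 // ler_peMr.
have tE : M%:R * (2 * t ^+ 2) = 2^-1.
  by rewrite -ss /t; field; rewrite gt_eqF.
have h1 := binw_exp_moment M t2.
have h2 := @binw_exp_moment R M (- t); rewrite normrN sqrrN in h2.
have {h1 h2} h := lerD h1 (h2 t2); rewrite !tE in h.
apply: le_trans (ler_wpM2l C0 h); rewrite -big_split mulr_sumr /=.
apply: ler_sum => k _; rewrite -mulrDr mulrCA ler_wpM2l ?binw_ge0 //.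
apply: (le_trans (H _ (normr_ge0 _))); rewrite ler_wpM2l //.
have xt : (M%:R - 2 * k%:R) * t = 2^-1 * binx R M k.
  by rewrite /binx -/s /t; field; rewrite gt_eqF.
rewrite mulrN xt; have [x0|x0] := leP 0 (binx R M k).
  by rewrite ger0_norm // lerDl expR_ge0.
by rewrite ltr0_norm // mulrN lerDr expR_ge0.
Qed.

(** * The discrete Stein operator *)

(** This and [binw_sumR] are the two absorption identities for binomial
coefficients; the average and the integration by parts below are their sum and
their difference. *)
Lemma binw_sumL (R : realType) N (g : nat -> R) :
  \sum_(k < N.+2) binw R N.+1 k * ((N.+1%:R - k%:R) * g k)
  = N.+1%:R / 2 * \sum_(k < N.+1) binw R N k * g k.
Proof.
rewrite big_ord_recr /= subrr mul0r mulr0 addr0 mulr_sumr.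
apply: eq_bigr => k _.
have kN : (k <= N.+1)%N by rewrite ltnW.
have := congr1 (fun n => n%:R : R) (mul_bin_down N.+1 k).
rewrite /= !natrM natrB // => E.
rewrite /binw !mulrA [X in X * g k]mulrAC (mulrC _ (_ - _)) -E exprS invfM.
by field; rewrite expf_neq0 // pnatr_eq0.
Qed.

Lemma binw_sumR (R : realType) N (g : nat -> R) :
  \sum_(k < N.+2) binw R N.+1 k * (k%:R * g k)
  = N.+1%:R / 2 * \sum_(k < N.+1) binw R N k * g k.+1.
Proof.
rewrite big_ord_recl /= mul0r mulr0 add0r mulr_sumr.
apply: eq_bigr => k _; rewrite /bump /= add1n.
have := congr1 (fun n => n%:R : R) (mul_bin_diag N.+1 k).
rewrite /= !natrM => E.
rewrite /binw !mulrA [X in X * g _]mulrAC (mulrC _ k.+1%:R) -E exprS invfM.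
by field; rewrite expf_neq0 // pnatr_eq0.
Qed.

Lemma binw_avg (R : realType) N (g : nat -> R) :
  \sum_(k < N.+2) binw R N.+1 k * g k
  = 2^-1 * \sum_(k < N.+1) binw R N k * (g k + g k.+1).
Proof.
have N0 : N.+1%:R != 0 :> R by rewrite pnatr_eq0.
apply: (mulfI N0); rewrite mulrA.
under [in RHS]eq_bigr do rewrite mulrDr.
rewrite big_split mulrDr -binw_sumL -binw_sumR -big_split mulr_sumr /=.
by apply: eq_bigr => k _; ring.
Qed.

Lemma binw_ibp (R : realType) N (g : nat -> R) :
  \sum_(k < N.+2) binw R N.+1 k * (binx R N.+1 k * g k)
  = Num.sqrt N.+1%:R / 2 * \sum_(k < N.+1) binw R N k * (g k - g k.+1).
Proof.
have s0 := sqrt_nat_gt0 R (ltn0Sn N); have ss := sqr_sqrt_nat R N.+1.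
set s := Num.sqrt _ in s0 ss *.
have sn0 : s != 0 by rewrite gt_eqF.
apply: (mulfI sn0).
under [in RHS]eq_bigr do rewrite mulrBr.
rewrite sumrB mulrA mulrA -expr2 ss mulrBr -binw_sumL -binw_sumR -sumrB.
rewrite mulr_sumr; apply: eq_bigr => k _.
by rewrite /binx -/s; field.
Qed.

(** Summation by parts turns the discrete Stein operator into differences of
[f] over steps of length [2 / sqrt M], where the trapezoidal rule applies. *)
Lemma discrete_stein (R : realType) (f df : R -> R) (C : R) (p : nat) :
  0 <= C -> (forall x : R, is_derive x 1 f (df x)) ->
  (forall a b, `|a - b| <= 2 ->
     `|df a - df b| <= C * `|a - b| * (1 + `|a|) ^+ p) ->
  exists2 D : R, 0 <= D & forall M, (1 <= M)%N ->
    `|\sum_(k < M.+1) binw R M k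
        * (df (binx R M k) - binx R M k * f (binx R M k))|
    <= D / Num.sqrt M%:R.
Proof.
move=> C0 fdf Lip; have [D D0 HD] := binw_moment R p.
exists (2 * C * D) => [|[//|N] _]; first by rewrite !mulr_ge0.
have s0 := sqrt_nat_gt0 R (ltn0Sn N); have ss := sqr_sqrt_nat R N.+1.
have := HD N.+1 isT.
set s := Num.sqrt _ in s0 ss *; set x := binx R N.+1 => HDN.
have s1 : 1 <= s by rewrite -sqrtr1 ler_sqrt ?ler1n // ltr0n.
pose h := 2 / s; have h0 : 0 < h by rewrite divr_gt0.
have h2 : h <= 2 by rewrite ler_pdivrMr // ler_peMr.
have xS k : x k = x k.+1 + h.
  by rewrite /x /binx -/s /h -natr1; field; rewrite gt_eqF.
under eq_bigr do rewrite mulrBr.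
rewrite sumrB (binw_avg N (fun k => df (x k))) (binw_ibp N (fun k => f (x k)))
  -/s !mulr_sumr -sumrB.
apply: (@le_trans _ _ (\sum_(k < N.+1) binw R N k *
   (C * h / 2 * ((1 + `|x k|) ^+ p + (1 + `|x k.+1|) ^+ p)))).
  rewrite (le_trans (ler_norm_sum _ _ _)) //; apply: ler_sum => k _.
  have -> : 2^-1 * (binw R N k * (df (x k) + df (x k.+1)))
      - s / 2 * (binw R N k * (f (x k) - f (x k.+1)))
    = binw R N k * (2^-1 * (df (x k) + df (x k.+1))
        - s / 2 * (f (x k) - f (x k.+1))) by ring.
  rewrite normrM ger0_norm ?binw_ge0 // ler_wpM2l ?binw_ge0 //.
  have xlt : x k.+1 < x k by rewrite (xS k) ltrDl.
  have cf : {within `[x k.+1, x k], continuous f}.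
    apply: derivable_within_continuous => y _.
    exact: (@ex_derive _ _ _ _ _ _ _ (fdf y)).
  have [c] := MVT xlt (fun y _ => fdf y) cf.
  rewrite in_itv /= => /andP[c1 c2] ->.
  rewrite (_ : x k - x k.+1 = h); last by rewrite (xS k) addrAC subrr add0r.
  have -> : 2^-1 * (df (x k) + df (x k.+1)) - s / 2 * (df c * h)
     = 2^-1 * (df (x k) - df c) + 2^-1 * (df (x k.+1) - df c).
    by rewrite /h; field; rewrite gt_eqF.
  have d1 : `|x k - c| <= h.
    by rewrite ger0_norm ?subr_ge0 ?(ltW c2) // lerBlDl; rewrite (xS k) lerD2r
      ltW.
  have d2 : `|x k.+1 - c| <= h.
    rewrite distrC ger0_norm ?subr_ge0 ?(ltW c1) // lerBlDl.
    by rewrite -xS ltW.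
  have e1 := Lip _ _ (le_trans d1 h2); have e2 := Lip _ _ (le_trans d2 h2).
  rewrite (le_trans (ler_normD _ _)) // !(normrM 2^-1) ger0_norm ?invr_ge0 //.
  rewrite (mulrC _ 2^-1) -mulrA mulrDr mulrDr lerD //; rewrite ler_wpM2l
    ?invr_ge0 //.
    by rewrite (le_trans e1) // ler_wpM2r ?exprn_ge0 ?addr_ge0 // ler_wpM2l.
  by rewrite (le_trans e2) // ler_wpM2r ?exprn_ge0 ?addr_ge0 // ler_wpM2l.
under eq_bigr do rewrite mulrCA.
have -> : 2 * C * D / s = C * h * D by rewrite /h; ring.
rewrite -mulr_sumr -mulrA ler_wpM2l ?mulr_ge0 ?invr_ge0 ?(ltW s0) //.
by have /= <- := binw_avg N (fun k => (1 + `|x k|) ^+ p).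
Qed.

(** * Gaussian weights *)

Definition gaussf (R : realType) (x : R) : R := expR (- (x ^+ 2 / 2)).

Lemma gaussf_gt0 (R : realType) (x : R) : 0 < gaussf x.
Proof. exact: expR_gt0. Qed.

Lemma gaussfN (R : realType) (x : R) : gaussf (- x) = gaussf x.
Proof. by rewrite /gaussf sqrrN. Qed.

Lemma gaussf_horner (R : realType) :
  @gaussf R = expR \o horner (- 2^-1 *: 'X^2).
Proof.
apply/funext => y /=; rewrite /gaussf hornerZ hornerXn; congr expR.
by rewrite mulNr mulrC.
Qed.

Lemma is_derive_gaussf (R : realType) (x : R) :
  is_derive x 1 (@gaussf R) (- x * gaussf x).
Proof.
rewrite gaussf_horner; apply: is_derive_eq; rewrite mulrC; congr (_ * _).
by rewrite derivZ derivXn /= hornerZ hornerMn hornerX -mulr_natr; field.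
Qed.

Lemma continuous_gaussf (R : realType) : continuous (@gaussf R).
Proof.
move=> x; apply/differentiable_continuous/derivable1_diffP.
exact: (@ex_derive _ _ _ _ _ _ _ (is_derive_gaussf x)).
Qed.

Lemma is_derive_poly_gaussf (R : realType) (P : {poly R}) (x : R) :
  is_derive x 1 (fun y => P.[y] * gaussf y) ((P^`() - 'X * P).[x] * gaussf x).
Proof.
have h := is_deriveM (is_derive_poly P x) (is_derive_gaussf x).
apply: (is_derive_eq h).
rewrite hornerD hornerN hornerM hornerX /GRing.scale /=; ring.
Qed.

(** Differentiating [P * gaussf] replaces [P] by [P' - X P]. *)
Lemma hermiteE (R : realType) (m : nat) (x : R) :
  hermite m x = (hermp R m).[x].
Proof.
have E : derive1n m (fun t : R => expR (- (t ^+ 2 / 2)))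
    = fun y => ((-1) ^+ m *: hermp R m).[y] * gaussf y.
  elim: m => [|m IH].
    by apply/funext => y; rewrite /= expr0 scale1r hornerC mul1r.
  rewrite derive1nS IH; apply/funext => y; rewrite derive1E.
  have := is_derive_poly_gaussf ((-1) ^+ m *: hermp R m) y.
  move=> /(@derive_val _ _ _ _ _ _ _) ->; congr (_.[y] * _).
  by rewrite derivZ -scalerAr -scalerBr /= exprS mulN1r scaleNr -scalerN opprB.
have e1 : expR (x ^+ 2 / 2) * gaussf x = 1.
  by rewrite /gaussf -expRD subrr expR0.
have s1 : (-1) ^+ m * (-1) ^+ m = 1 :> R by rewrite -exprMn mulrNN mulr1 expr1n.
rewrite /hermite E hornerZ.
transitivity ((-1) ^+ m * (-1) ^+ m * (expR (x ^+ 2 / 2) * gaussf x)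
  * (hermp R m).[x]); first by ring.
by rewrite e1 s1 !mul1r.
Qed.

Lemma horner_growth (R : realType) (H : {poly R}) (x : R) :
  `|H.[x]| <= norm1 H * (1 + `|x|) ^+ size H.
Proof.
rewrite horner_coef (le_trans (ler_norm_sum _ _ _)) // /norm1 mulr_suml.
apply: ler_sum => i _; rewrite normrM normrX ler_wpM2l //.
apply: (@le_trans _ _ ((1 + `|x|) ^+ i)).
  by rewrite lerXn2r ?nnegrE ?addr_ge0 // lerDr.
by rewrite ler_weXn2l ?lerDl // ltnW.
Qed.

Lemma Rintegral_gaussf (R : realType) :
  \int[lebesgue_measure]_(x in [set: R]) gaussf x = Num.sqrt (2 * pi).
Proof.
have k0 := normal_peak_gt0 (oner_neq0 R).
have E : @gaussf R = fun x => (normal_peak 1)^-1 * normal_pdf 0 1 x.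
  apply/funext => x; rewrite normal_pdfE ?oner_neq0 // mulKf ?gt_eqF //.
  by rewrite /normal_fun subr0 expr1n mulNr.
rewrite E RintegralZl //; last exact: integrable_normal_pdf.
rewrite /Rintegral integral_normal_pdf /= mulr1 /normal_peak invrK.
by rewrite expr1n mul1r mulr_natl.
Qed.

(** The Gaussian density of twice the variance serves as a majorant, because
it is known to be integrable. *)
Lemma pow_gaussf_bound (R : realType) (p : nat) : exists2 C, 0 <= C &
  forall x : R, (1 + `|x|) ^+ p * gaussf x <= C * normal_pdf 0 (Num.sqrt 2) x.
Proof.
have s2 : Num.sqrt 2 != 0 :> R by rewrite gt_eqF // sqrtr_gt0.
have [C C0 H] := pow_le_expR p (@ltr01 R).
have k0 := normal_peak_gt0 s2.
(* [|x| <= 1 + x ^ 2 / 4] *)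
exists (C * expR 1 / normal_peak (Num.sqrt 2)) => [|x].
  by rewrite !mulr_ge0 ?expR_ge0 // invr_ge0 ltW.
rewrite normal_pdfE // /normal_fun subr0 sqr_sqrtr // mulrA divfK ?gt_eqF //.
have := H `|x| (normr_ge0 x); rewrite mul1r => h.
apply: (le_trans (ler_wpM2r (ltW (gaussf_gt0 x)) h)).
rewrite -!mulrA ler_wpM2l // /gaussf -!expRD ler_expR -(real_normK (num_real
  x)).
rewrite -subr_ge0 (_ : _ - _ = (`|x| / 2 - 1) ^+ 2) ?sqr_ge0 //.
by field.
Qed.

Lemma integrable_gauss_growth (R : realType) (q : R -> R) (C : R) (p : nat)
    (D : set R) : measurable D -> continuous q ->
  (forall x, `|q x| <= C * ((1 + `|x|) ^+ p * gaussf x)) ->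
  (@lebesgue_measure R).-integrable D (EFin \o q).
Proof.
move=> mD cq hq; have [K K0 HK] := pow_gaussf_bound R p.
have ig : (@lebesgue_measure R).-integrable setT
    (fun x => ((`|C| * K)%:E * (normal_pdf 0 (Num.sqrt 2) x)%:E)%E).
  by apply: integrableZl => //; exact: integrable_normal_pdf.
have iT : (@lebesgue_measure R).-integrable setT (EFin \o q).
  apply: le_integrable ig => //.
    by apply/measurable_EFinP; exact: continuous_measurable_fun.
  move=> x _; rewrite -EFinM !abse_EFin lee_fin.
  rewrite [leRHS]ger0_norm ?mulr_ge0 ?normal_pdf_ge0 // (le_trans (hq x)) //.
  rewrite -mulrA (le_trans (ler_norm _)) // normrM ler_wpM2l //.
  by rewrite ger0_norm ?mulr_ge0 ?exprn_ge0 ?addr_ge0 // ltW // gaussf_gt0.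
exact: (integrableS measurableT).
Qed.

Lemma cvg_pow_gaussf (R : realType) (p : nat) :
  (x ^+ p * gaussf x @[x --> +oo] --> (0 : R))%R.
Proof.
have [C C0 H] := pow_gaussf_bound R p.+1.
have s2 : Num.sqrt 2 != 0 :> R by rewrite gt_eqF // sqrtr_gt0.
pose K := C * normal_peak (Num.sqrt 2 : R).
have K0 : 0 <= K by rewrite mulr_ge0 ?normal_peak_ge0.
have HK (x : R) : (1 + `|x|) ^+ p.+1 * gaussf x <= K.
  by rewrite (le_trans (H x)) // ler_wpM2l // normal_pdf_ub.
apply/cvgrPdist_le => e e0; near=> x.
have x0 : 0 <= x by near: x; exact: nbhs_pinfty_ge.
have xK : K / e <= x by near: x; apply: nbhs_pinfty_ge; rewrite num_real.
have x1 : 0 < 1 + x by rewrite ltr_wpDr.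
rewrite sub0r normrN ger0_norm; last by rewrite mulr_ge0 ?exprn_ge0 ?ltW
  ?gaussf_gt0.
rewrite -(ler_pM2l x1) (@le_trans _ _ K) //.
  rewrite (le_trans _ (HK x)) // exprS -mulrA ger0_norm // ler_wpM2l ?(ltW x1)
    //.
  by rewrite ler_wpM2r ?(ltW (gaussf_gt0 _)) // lerXn2r ?nnegrE ?addr_ge0
    ?lerDr.
by rewrite -ler_pdivrMr // (le_trans xK) // lerDr.
Unshelve. all: by end_near. Qed.

Lemma continuous_poly_gaussf (R : realType) (P : {poly R}) :
  continuous (fun y => P.[y] * gaussf y).
Proof.
by move=> x; apply: cvgM; [exact: continuous_horner|exact: continuous_gaussf].
Qed.

Lemma integrable_poly_gaussf (R : realType) (P : {poly R}) (D : set R) :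
  measurable D ->
  (@lebesgue_measure R).-integrable D (EFin \o (fun y => P.[y] * gaussf y)).
Proof.
move=> mD; apply: (integrable_gauss_growth (C := norm1 P) (p := size P)) => //.
  exact: continuous_poly_gaussf.
move=> x; rewrite normrM (ger0_norm (ltW (gaussf_gt0 x))) mulrA.
by rewrite ler_wpM2r ?(ltW (gaussf_gt0 _)) // horner_growth.
Qed.

(** The derivative of [- t ^+ p.+1 * gaussf t] dominates [t ^+ p * gaussf t]
from [p + 2] on. *)
Lemma gauss_tail (R : realType) (p : nat) (x : R) : p.+2%:R <= x ->
  \int[lebesgue_measure]_(t in `[x, +oo[) (t ^+ p * gaussf t)
  <= x ^+ p.+1 * gaussf x.
Proof.
move=> px; pose P : {poly R} := - 'X^(p.+1).
pose r y := (P^`() - 'X * P).[y] * gaussf y.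
have dP y := is_derive_poly_gaussf P y.
have rE y : r y = (y ^+ p.+2 - p.+1%:R * y ^+ p) * gaussf y.
  rewrite /r /P derivN derivXn /= !(hornerE, hornerMn) /=; congr (_ * _).
  by rewrite !exprS -mulr_natl; ring.
have pr t : x <= t -> t ^+ p * gaussf t <= r t.
  move=> xt; rewrite rE ler_wpM2r ?(ltW (gaussf_gt0 _)) //.
  have pt := le_trans px xt; have t0 : 0 <= t by rewrite (le_trans _ pt).
  rewrite !exprS -subr_ge0 (_ : _ - _ = (t * t - p.+2%:R) * t ^+ p).
    rewrite mulr_ge0 ?exprn_ge0 // subr_ge0 (le_trans pt) // ler_peMl //.
    by rewrite (le_trans _ pt) // ler1n.
  by rewrite -[p.+2%:R]natr1; ring.
have -> : x ^+ p.+1 * gaussf x = \int[lebesgue_measure]_(t in `[x, +oo[) r t.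
  rewrite (@Rintegral_ge0_continuous_FTC2y R r (fun y => P.[y] * gaussf y) x 0).
  - by rewrite /P hornerN hornerXn mulNr sub0r opprK.
  - move=> t xt; rewrite (le_trans _ (pr t xt)) // mulr_ge0 ?exprn_ge0 //.
      by rewrite (le_trans _ (le_trans px xt)).
    exact: ltW (gaussf_gt0 _).
  - exact/continuous_subspaceT/continuous_poly_gaussf.
  - rewrite (_ : (fun y => _) = (fun y => - (y ^+ p.+1 * gaussf y))).
      by rewrite -oppr0; apply: cvgN; exact: cvg_pow_gaussf.
    by apply/funext => y; rewrite /P hornerN hornerXn mulNr.
  - by move=> y _; exact: (@ex_derive _ _ _ _ _ _ _ (dP y)).
  - exact/cvg_at_right_filter/continuous_poly_gaussf.
  - by move=> y _; rewrite derive1E; exact: (@derive_val _ _ _ _ _ _ _ (dP y)).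
apply: le_Rintegral => //.
- have := @integrable_poly_gaussf R 'X^p `[x, +oo[ (measurable_itv _).
  by under [X in _ \o X]funext do rewrite hornerXn.
- exact: integrable_poly_gaussf.
- by move=> t /=; rewrite in_itv /= andbT => /pr.
Qed.

(** Since [1 + t <= 2 * t] for [t >= 1], the growth reduces to a monomial. *)
Lemma gauss_growth_tail (R : realType) (q : R -> R) (C : R) (p : nat) (x : R) :
  0 <= C -> continuous q ->
  (forall x, `|q x| <= C * ((1 + `|x|) ^+ p * gaussf x)) ->
  p.+2%:R <= x ->
  \int[lebesgue_measure]_(t in `[x, +oo[) `|q t|
  <= C * 2 ^+ p * ((1 + `|x|) ^+ p.+1 * gaussf x).
Proof.
move=> C0 cq hq px.
have x0 : 0 <= x by rewrite (le_trans _ px).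
have iXp : (@lebesgue_measure R).-integrable `[x, +oo[
    (EFin \o (fun t => t ^+ p * gaussf t)).
  have := @integrable_poly_gaussf R 'X^p `[x, +oo[ (measurable_itv _).
  by under [X in _ \o X]funext do rewrite hornerXn.
apply: (@le_trans _ _ (\int[lebesgue_measure]_(t in `[x, +oo[)
   (C * 2 ^+ p * (t ^+ p * gaussf t)))).
  apply: le_Rintegral => //.
  - apply: (integrable_gauss_growth (C := C) (p := p)) => //.
      by move=> t; apply: continuous_comp (cq t) _; exact: norm_continuous.
    by move=> t; rewrite normr_id.
  - by apply: (integrableZl _ (C * 2 ^+ p) iXp).
  - move=> t /=; rewrite in_itv /= andbT => xt; rewrite (le_trans (hq t)) //.
    rewrite -!mulrA ler_wpM2l // mulrA ler_wpM2r ?(ltW (gaussf_gt0 _)) //.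
    have t1 : 1 <= t by rewrite (le_trans _ (le_trans px xt)) // ler1n.
    have t0 : 0 <= t by rewrite (le_trans _ t1).
    rewrite -exprMn lerXn2r ?nnegrE ?addr_ge0 ?mulr_ge0 // ger0_norm //.
    by rewrite mulr2n mulrDl mul1r lerD2r.
rewrite RintegralZl // ler_wpM2l ?mulr_ge0 ?exprn_ge0 //.
rewrite (le_trans (gauss_tail px)) // ler_wpM2r ?(ltW (gaussf_gt0 _)) //.
by rewrite ger0_norm // lerXn2r ?nnegrE ?addr_ge0 // lerDr.
Qed.

(** The total integral being 0, the primitive from the left is minus the one
from the right, so that the tail estimate applies at both ends. *)
Lemma gauss_primitive (R : realType) (q : R -> R) (C : R) (p : nat) :
  0 <= C -> continuous q ->
  (forall x, `|q x| <= C * ((1 + `|x|) ^+ p * gaussf x)) ->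
  \int[lebesgue_measure]_(t in [set: R]) q t = 0 ->
  exists F : R -> R, (forall x : R, is_derive x 1 F (q x)) /\
  exists2 K, 0 <= K &
    forall x, `|F x| <= K * ((1 + `|x|) ^+ p.+1 * gaussf x).
Proof.
move=> C0 cq hq q0; set mu := @lebesgue_measure R.
have iq D : measurable D -> mu.-integrable D (EFin \o q).
  by move=> mD; exact: integrable_gauss_growth hq.
have caq : continuous (fun x => `|q x|).
  by move=> t; apply: continuous_comp (cq t) _; exact: norm_continuous.
have haq x : `|(`|q x|)| <= C * ((1 + `|x|) ^+ p * gaussf x) by rewrite
  normr_id.
have iaq D : measurable D -> mu.-integrable D (EFin \o (fun x => `|q x|)).
  by move=> mD; exact: integrable_gauss_growth haq.
pose F x := \int[mu]_(t in `]-oo, x]) q t; exists F; split.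
  move=> x; have xu : x < x + 1 by rewrite ltrDl.
  have [dF F'] := continuous_FTC1 (a := -oo%O) xu (iq _ (measurable_itv _))
    (ltNyr _) (cq x).
  by apply: DeriveDef => //; rewrite -derive1E.
pose Q := \int[mu]_(t in [set: R]) `|q t|.
have Q0 : 0 <= Q by apply: Rintegral_ge0.
pose X : R := p.+2%:R; pose g := gaussf X; have g0 : 0 < g := gaussf_gt0 X.
pose K1 := C * 2 ^+ p.
have K10 : 0 <= K1 by rewrite mulr_ge0 ?exprn_ge0.
have W0 x : 0 <= (1 + `|x|) ^+ p.+1 * gaussf x.
  by rewrite mulr_ge0 ?exprn_ge0 ?addr_ge0 // ltW // gaussf_gt0.
have FE x : F x = - \int[mu]_(t in `]x, +oo[) q t.
  apply/eqP; rewrite -addr_eq0; apply/eqP; rewrite -q0.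
  rewrite -(itv_setU_setT false x) Rintegral_setU //.
    by rewrite itv_setU_setT; exact: iq.
  apply/disj_setPS => t [] /=; rewrite !in_itv /= andbT => h1 h2.
  by move: (lt_le_trans h2 h1); rewrite ltxx.
(* [Q / g] serves for [|x| <= X], and [K1] for the tails. *)
exists (K1 + Q / g) => [|x]; first by rewrite addr_ge0 // divr_ge0 // ltW.
have [xX|Xx] := leP `|x| X.
  have FQ : `|F x| <= Q.
    apply: (le_trans (le_normr_Rintegral _ (iq _ _))) => //.
    rewrite /Q -(itv_setU_setT false x) Rintegral_setU //.
    - by rewrite lerDl Rintegral_ge0.
    - by rewrite itv_setU_setT; exact: iaq.
    - apply/disj_setPS => t [] /=; rewrite !in_itv /= andbT => h1 h2.
      by move: (lt_le_trans h2 h1); rewrite ltxx.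
  apply: (le_trans FQ).
  apply: (@le_trans _ _ (Q / g * ((1 + `|x|) ^+ p.+1 * gaussf x))); last first.
    by rewrite ler_wpM2r ?W0 // lerDr.
  rewrite -[Q / g * _]mulrA ler_peMr // ler_pdivlMl // mulr1.
  apply: (@le_trans _ _ (gaussf x)).
    rewrite ler_expR lerN2 ler_pM2r // -(real_normK (num_real x)).
    by rewrite lerXn2r ?nnegrE.
  rewrite ler_peMl ?(ltW (gaussf_gt0 _)) // exprn_ege1 // lerDl //.
apply: (@le_trans _ _ (K1 * ((1 + `|x|) ^+ p.+1 * gaussf x))); last first.
  by rewrite mulrDl lerDl mulr_ge0 // divr_ge0 // ltW.
have [x0|x0] := leP 0 x.
  rewrite ger0_norm // in Xx.
  rewrite FE normrN (le_trans (le_normr_Rintegral _ (iq _ _))) //.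
  rewrite Rintegral_itv_obnd_cbnd; last exact: iaq.
  exact: gauss_growth_tail (ltW Xx).
rewrite ltr0_norm // in Xx.
apply: (le_trans (le_normr_Rintegral _ (iq _ _))) => //.
rewrite -[x]opprK; set y := - x.
have -> : \int[mu]_(t in `]-oo, (- y)]) `|q t|
    = \int[mu]_(t in `[y, +oo[) `|q (- t)|.
  by rewrite /Rintegral ge0_integration_by_substitutionNy //;
    exact: continuous_subspaceT.
rewrite normrN gaussfN; apply: gauss_growth_tail (ltW Xx) => //.
  move=> t; apply: continuous_comp; [exact: opp_continuous|exact: cq].
by move=> t; rewrite (le_trans (hq _)) // normrN gaussfN.
Qed.

(** * Binomial and Gaussian means of the absolute value of a polynomial *)

Lemma mean_value_between (R : realType) (f df : R -> R) (a b : R) :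
  (forall x : R, is_derive x 1 f (df x)) ->
  exists2 c, `|a - c| <= `|a - b| & f a - f b = df c * (a - b).
Proof.
move=> fdf.
have cf x y : {within `[x, y], continuous f}.
  apply: derivable_within_continuous => z _.
  exact: (@ex_derive _ _ _ _ _ _ _ (fdf z)).
have [ab|ab] := leP a b.
  have [c] := MVT_segment ab (fun y _ => fdf y) (cf a b).
  rewrite in_itv /= => /andP[ac cb] E; exists c.
    by rewrite !(distrC a) !ger0_norm ?subr_ge0 // lerD2r.
  by rewrite -opprB E -mulrN opprB.
have [c] := MVT_segment (ltW ab) (fun y _ => fdf y) (cf b a).
rewrite in_itv /= => /andP[bc ca] E; exists c => //.
by rewrite !ger0_norm ?subr_ge0 ?(ltW ab) // lerD2l lerN2.
Qed.

(** Stein's method: [f = F / gaussf] solves [f' - x f = |H| - c], grows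
polynomially, and its derivative is locally Lipschitz although [|H|] has
corners at the roots of [H]; the discrete Stein operator of the binomial law
is therefore evaluated with an error [O(1 / sqrt M)]. *)
Lemma binomial_gauss_absH (R : realType) (H : {poly R}) :
  exists2 D : R, 0 <= D & forall M, (1 <= M)%N ->
  `|\sum_(k < M.+1) binw R M k * `|H.[binx R M k]|
    - (\int[lebesgue_measure]_(x in [set: R]) (`|H.[x]| * gaussf x))
      / Num.sqrt (2 * pi)| <= D / Num.sqrt M%:R.
Proof.
set c := _ / Num.sqrt (2 * pi); set s := size H; set N := norm1 H.
have N0 : 0 <= N := norm1_ge0 H.
have cH : continuous (fun x => `|H.[x]|).
  move=> t; apply: continuous_comp; first exact: continuous_horner.
  exact: norm_continuous.
have W1 (x : R) : 1 <= 1 + `|x| by rewrite lerDl.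
have W0 (x : R) n : 0 <= (1 + `|x|) ^+ n by rewrite exprn_ge0 ?addr_ge0.
have Wle (x : R) n n' : (n <= n')%N -> (1 + `|x|) ^+ n <= (1 + `|x|) ^+ n'.
  by move=> nn'; rewrite ler_weXn2l.
have Wge1 (x : R) n : 1 <= (1 + `|x|) ^+ n by rewrite exprn_ege1.
pose q (x : R) : R := (`|H.[x]| - c) * gaussf x.
have gc x : `| `|H.[x]| - c| <= (N + `|c|) * (1 + `|x|) ^+ s.
  rewrite (le_trans (ler_normB _ _)) // normr_id mulrDl lerD ?horner_growth //.
  by rewrite ler_peMr.
have cq : continuous q.
  move=> t; apply: cvgM; last exact: continuous_gaussf.
  by apply: cvgB; [exact: cH|exact: cvg_cst].
have hq x : `|q x| <= (N + `|c|) * ((1 + `|x|) ^+ s * gaussf x).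
  rewrite normrM (ger0_norm (ltW (gaussf_gt0 x))) mulrA.
  by rewrite ler_wpM2r ?gc // ltW // gaussf_gt0.
have sp0 : 0 < Num.sqrt (2 * pi) :> R.
  by rewrite sqrtr_gt0 mulr_gt0 ?pi_gt0.
have q0 : \int[lebesgue_measure]_(t in [set: R]) q t = 0.
  rewrite /q; under eq_Rintegral do rewrite mulrBl.
  rewrite RintegralB //.
  - rewrite RintegralZl //; last first.
      apply: (integrable_gauss_growth (C := 1) (p := 0)) => //.
        exact: continuous_gaussf.
      by move=> x; rewrite expr0 !mul1r ger0_norm // ltW // gaussf_gt0.
    by rewrite Rintegral_gaussf /c divfK ?subrr // gt_eqF.
  - apply: (integrable_gauss_growth (C := N) (p := s)) => //.
      move=> t; apply: cvgM; [exact: cH|exact: continuous_gaussf].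
    move=> x; rewrite normrM normr_id (ger0_norm (ltW (gaussf_gt0 x))) mulrA.
    by rewrite ler_wpM2r ?horner_growth // ltW // gaussf_gt0.
  - apply: (integrable_gauss_growth (C := `|c|) (p := 0)) => //.
      move=> t; apply: cvgM; [exact: cvg_cst|exact: continuous_gaussf].
    move=> x; rewrite normrM expr0 mul1r.
    by rewrite (ger0_norm (ltW (gaussf_gt0 x))).
have [F [dF [K K0 hF]]] := gauss_primitive (addr_ge0 N0 (normr_ge0 c)) cq hq q0.
pose e : R -> R := expR \o horner (2^-1 *: 'X^2).
have de (x : R) : is_derive x 1 e (x * e x).
  rewrite /e; apply: is_derive_eq; rewrite mulrC; congr (_ * _).
  by rewrite derivZ derivXn /= hornerZ hornerMn hornerX -mulr_natr; field.
have eg x : e x * gaussf x = 1.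
  rewrite /e /= hornerZ hornerXn /gaussf -expRD mulrC subrr expR0 //.
pose f (x : R) : R := F x * e x; pose df (x : R) : R := x * f x + (`|H.[x]| -
  c).
have dfP (x : R) : is_derive x 1 f (df x).
  have h := is_deriveM (dF x) (de x); apply: (is_derive_eq h).
  rewrite /GRing.scale /= /df /f /q.
  transitivity (x * (F x * e x) + (`|H.[x]| - c) * (e x * gaussf x)).
    by ring.
  by rewrite eg mulr1.
have hf x : `|f x| <= K * (1 + `|x|) ^+ s.+1.
  rewrite /f normrM (ger0_norm (expR_ge0 _ : 0 <= e x)).
  rewrite (le_trans (ler_wpM2r (expR_ge0 _ : 0 <= e x) (hF x))) //.
  by rewrite -!mulrA (mulrC (gaussf x)) eg mulr1.
pose B := K + (N + `|c|).
have B0 : 0 <= B by rewrite !addr_ge0.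
have hdf x : `|df x| <= B * (1 + `|x|) ^+ s.+2.
  rewrite (le_trans (ler_normD _ _)) // mulrDl lerD //.
    rewrite normrM exprS mulrCA ler_pM // lerDr //.
  by rewrite (le_trans (gc x)) // ler_wpM2l ?addr_ge0 // Wle // (leq_addl 2).
pose N' := norm1 H^`().
have N'0 : 0 <= N' := norm1_ge0 _.
pose L := K + 3 ^+ s.+3 * B + 3 ^+ s * N'.
have L0 : 0 <= L.
  by do 2?[apply: addr_ge0 => //]; apply: mulr_ge0 => //; apply: exprn_ge0.
have W3 (a b : R) n : `|a - b| <= 2 ->
    (1 + `|b|) ^+ n <= 3 ^+ n * (1 + `|a|) ^+ n.
  move=> ab; rewrite -exprMn lerXn2r ?nnegrE ?mulr_ge0 ?addr_ge0 //.
  have : `|b| <= `|a| + `|a - b|.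
    by rewrite -[X in `|X|](subKr a) (le_trans (ler_normB _ _)).
  by have := normr_ge0 a; lra.
have Lip a b : `|a - b| <= 2 ->
    `|df a - df b| <= L * `|a - b| * (1 + `|a|) ^+ s.+3.
  move=> ab2.
  have [x ax fx] := mean_value_between a b dfP.
  have [y ay Hy] := mean_value_between a b (fun x => is_derive_poly H x).
  have -> : df a - df b = (a - b) * f a + b * (f a - f b)
      + (`|H.[a]| - `|H.[b]|) by rewrite /df; ring.
  rewrite (_ : L * _ * _ = `|a - b| * (K * (1 + `|a|) ^+ s.+3)
    + `|a - b| * (3 ^+ s.+3 * B * (1 + `|a|) ^+ s.+3)
    + `|a - b| * (3 ^+ s * N' * (1 + `|a|) ^+ s.+3)); last by rewrite /L; ring.
  rewrite (le_trans (ler_normD _ _)) // lerD //.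
    rewrite (le_trans (ler_normD _ _)) // lerD // normrM.
      by rewrite ler_wpM2l // (le_trans (hf a)) // ler_wpM2l // Wle //
        (leq_addl 2).
    rewrite fx normrM mulrA [leLHS]mulrC ler_wpM2l //.
    apply: (@le_trans _ _ ((1 + `|b|) * (B * (1 + `|x|) ^+ s.+2))).
      by rewrite ler_pM // lerDr.
    rewrite [leRHS](_ : _ = (3 * (1 + `|a|)) *
      (B * (3 ^+ s.+2 * (1 + `|a|) ^+ s.+2))); last first.
      by rewrite (exprS _ s.+2) (exprS (1 + `|a|) s.+2); ring.
    apply: ler_pM; [by rewrite addr_ge0|by rewrite mulr_ge0| |].
      by have := W3 a b 1%N ab2; rewrite !expr1.
    by rewrite ler_wpM2l // W3 // (le_trans ax).
  rewrite (le_trans (ler_dist_dist _ _)) // Hy normrM mulrC ler_wpM2l //.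
  rewrite (le_trans (horner_growth _ _)) // (mulrC _ N') -mulrA ler_wpM2l //.
  apply: (@le_trans _ _ ((1 + `|y|) ^+ s)).
    apply: Wle; have [->|H0] := eqVneq H 0; first by rewrite deriv0 size_poly0.
    by rewrite ltnW // lt_size_deriv.
  rewrite (le_trans (W3 a y s _)) ?(le_trans ay) //.
  by rewrite ler_wpM2l ?exprn_ge0 // Wle // -addn3 leq_addr.
have [D D0 HD] := discrete_stein L0 dfP Lip.
exists D => // M M1; have := HD M M1.
rewrite (_ : \sum_(k < M.+1) _ = \sum_(k < M.+1) binw R M k * `|H.[binx R M k]|
  - c) //.
have <- : \sum_(k < M.+1) binw R M k * c = c.
  rewrite -mulr_suml (_ : \sum_(k < M.+1) _ = 1) ?mul1r //.
  rewrite -mulr_suml -natr_sum.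
  have -> : (\sum_(i < M.+1) 'C(M, i) = 2 ^ M)%N.
    rewrite -[(2 ^ M)%N]/((1 + 1) ^ M)%N expnDn; apply: eq_bigr => i _.
    by rewrite !exp1n !muln1.
  by rewrite natrX divff // expf_neq0 // pnatr_eq0.
rewrite -sumrB; apply: eq_bigr => k _.
by rewrite -mulrBr; congr (_ * _); rewrite /df addrAC subrr add0r.
Qed.

(** * Absolute sums of binomial differences *)

(** The generating polynomial of [2 ^- N] times the m-th differences of the
binomial coefficients, up to sign. *)
Definition diffpoly (R : realType) (N m : nat) : {poly R} :=
  binpoly R N * ('X - 1) ^+ m.

Lemma size_diffpoly (R : realType) N m :
  (size (diffpoly R N m) <= (N + m).+1)%N.
Proof.
rewrite (leq_trans (size_polyMleq _ _)) // -polyC1 size_exp_XsubC addnS /=.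
by rewrite -addSn leq_add2r size_binpoly.
Qed.

Lemma diffpolyE (R : realType) N m :
  diffpoly R N m = ((-1) ^+ m * 2 ^- N) *: krawp R (N + m) m.
Proof.
rewrite /diffpoly /krawp /binpoly addnK exprZn exprVn -(opprB 1 'X).
rewrite -scaleN1r exprZn -scalerAl -scalerAr scalerA.
by rewrite [(1 - _) ^+ _ * _]mulrC [_ * 2 ^- N]mulrC.
Qed.

Lemma normr_coef_diffpoly (R : realType) N m k : (1 <= N + m)%N ->
  let M := (N + m)%N in
  `|(diffpoly R N m)`_k| = 2 ^+ m / Num.sqrt M%:R ^+ m *
    (2 ^- M * `|Num.sqrt M%:R ^+ m * (krawp R M m)`_k|).
Proof.
move=> M1 M; have s0 := sqrt_nat_gt0 R M1.
rewrite diffpolyE -/M coefZ.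
have -> : 2 ^- N = 2 ^+ m * 2 ^- M :> R.
  by rewrite /M exprD invfM mulrCA divff ?mulr1 // expf_neq0.
rewrite !normrM !normfV !normrX normrN1 expr1n mul1r !normr_nat.
rewrite (ger0_norm (ltW s0)); field.
by rewrite !expf_neq0 // gt_eqF.
Qed.

Lemma one_sub_expr_le (R : realType) (z : R) n : 0 <= z <= 1 ->
  1 - z ^+ n <= n%:R * (1 - z).
Proof.
move=> /andP[z0 z1]; elim: n => [|n IH]; first by rewrite expr0 subrr mul0r.
rewrite exprS -natr1 mulrDl mul1r.
have -> : 1 - z * z ^+ n = z * (1 - z ^+ n) + (1 - z) by ring.
rewrite lerD2r (le_trans _ IH) // ler_piMl // subr_ge0.
by rewrite exprn_ile1.
Qed.

Lemma sum_coef_diffpoly (R : realType) N m K : (1 <= N + m)%N ->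
  let M := (N + m)%N in
  \sum_(k < K) `|(diffpoly R N m)`_k| = 2 ^+ m / Num.sqrt M%:R ^+ m *
    \sum_(k < K) (2 ^- M * `|Num.sqrt M%:R ^+ m * (krawp R M m)`_k|).
Proof.
move=> M1 M; rewrite mulr_sumr; apply: eq_bigr => k _.
by rewrite normr_coef_diffpoly.
Qed.

(** Each difference gains a factor of order [N^(-1/2)], which is the
normalization in [krawp_hermite]; the moments of the binomial law are bounded.
*)
Lemma norm1_diffpoly (R : realType) m :
  exists2 C : R, 0 <= C & forall N,
    norm1 (diffpoly R N m) <= C / Num.sqrt N.+1%:R ^+ m.
Proof.
have [C1 C10 H1] := krawp_hermite R m.
have [C2 C20 H2] := binw_moment R m.
exists (1 + 2 ^+ m * (C1 * C2)) => [|N].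
  by rewrite addr_ge0 ?mulr_ge0 ?exprn_ge0.
case: (posnP m) => [m0|m0].
  rewrite m0 /diffpoly !expr0 mulr1 divr1 (le_trans (norm1_binpoly _ _)) //.
  by rewrite lerDl mul1r mulr_ge0.
have M1 : (1 <= N + m)%N by rewrite addn_gt0 m0 orbT.
set t := Num.sqrt N.+1%:R; have t0 : 0 < t by exact: sqrt_nat_gt0.
have ts : t <= Num.sqrt (N + m)%:R.
  by rewrite ler_sqrt ?ler0n // ler_nat -addn1 leq_add2l.
rewrite (norm1E (size_diffpoly R N m)) sum_coef_diffpoly //.
set s := Num.sqrt _ in ts *; have s0 : 0 < s := lt_le_trans t0 ts.
apply: (@le_trans _ _ (2 ^+ m / s ^+ m * (C1 * C2))).
  rewrite ler_wpM2l ?divr_ge0 ?exprn_ge0 ?(ltW s0) //.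
  apply: le_trans (ler_wpM2l C10 (H2 _ M1)); rewrite mulr_sumr.
  apply: ler_sum => k _.
  have [h _] := H1 (N + m)%N k M1 (leq_addl _ _) (ltn_ord k).
  rewrite -/s in h; rewrite /binw (mulrC _ (2 ^- _)) mulrCA -mulrA.
  by rewrite ler_wpM2l ?invr_ge0 ?exprn_ge0 // (le_trans h) // mulrCA.
rewrite mulrAC ler_pM ?mulr_ge0 ?exprn_ge0 ?invr_ge0 ?exprn_ge0 ?(ltW s0) //.
  by rewrite lerDr.
by rewrite lef_pV2 ?posrE ?exprn_gt0 // lerXn2r ?nnegrE ?(ltW s0) ?(ltW t0).
Qed.

Lemma hconstE (R : realType) m : hconst R m =
  2 ^+ m * ((\int[lebesgue_measure]_(x in [set: R])
    (`|(hermp R m).[x]| * gaussf x)) / Num.sqrt (2 * pi)).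
Proof.
rewrite /hconst mulrAC -mulrA; congr (_ * (_ / _)).
by apply: eq_Rintegral => x _; rewrite hermiteE.
Qed.

(** By [krawp_hermite] the sum is the binomial mean of [|hermp R m|], up to
normalization, and [binomial_gauss_absH] compares it with the Gaussian mean.
The range stops short of the degree [N + m]; the missing values are extreme
ones, of standardized size at least [sqrt (N + m) / 2], so that Markov's
inequality discards them. *)
Lemma sum_diffpoly_asymp (R : realType) m :
  exists2 C : R, 0 <= C & forall N, (1 <= N)%N -> (3 * m <= N)%N ->
  `|\sum_(k < N.+1) `|(diffpoly R N m)`_k| - hconst R m / Num.sqrt N%:R ^+ m|
  <= C / Num.sqrt N%:R ^+ m.+1.
Proof.
have [C1 C10 H1] := krawp_hermite R m.
have [C2 C20 H2] := binw_moment R m.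
have [C3 C30 H3] := binw_moment R m.+1.
have [D D0 HD] := binomial_gauss_absH (hermp R m).
set c := (\int[_]_(_ in _) _) / _ in HD.
have c0 : 0 <= c.
  rewrite divr_ge0 ?sqrtr_ge0 // Rintegral_ge0 // => x _.
  by rewrite mulr_ge0 // ltW // gaussf_gt0.
pose E := C1 * C2 + D + 2 * (C1 * C3).
have E0 : 0 <= E by rewrite /E !addr_ge0 ?mulr_ge0.
exists (2 ^+ m * E + 2 ^+ m * c * (m%:R * m%:R)) => [|N N1 mN].
  have m0 : 0 <= (2 ^+ m : R) by rewrite exprn_ge0.
  by apply: addr_ge0; do 2?[apply: mulr_ge0 => //].
rewrite hconstE -/c.
pose M := (N + m)%N; have M1 : (1 <= M)%N by rewrite (leq_trans N1) ?leq_addr.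
have mM : (m <= M)%N by exact: leq_addl.
have s0 := sqrt_nat_gt0 R M1; have ss := sqr_sqrt_nat R M.
have t0 := sqrt_nat_gt0 R N1; have tt := sqr_sqrt_nat R N.
rewrite sum_coef_diffpoly // -/M.
set s := Num.sqrt M%:R in s0 ss *; set t := Num.sqrt N%:R in t0 tt *.
have ts : t <= s by rewrite ler_sqrt ?ler0n // ler_nat leq_addr.
have t1 : 1 <= t by rewrite -sqrtr1 ler_sqrt ?ler1n // ltr0n.
pose T K : R := \sum_(k < K) (2 ^- M * `|s ^+ m * (krawp R M m)`_k|).
have hT : `|T N.+1 - c| <= E / s.
  have e1 : `|T M.+1 - \sum_(k < M.+1) binw R M k * `|(hermp R m).[binx R M
    k]| |
      <= C1 * C2 / s.
    rewrite -sumrB (le_trans (ler_norm_sum _ _ _)) //.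
    apply: (@le_trans _ _ (C1 / M%:R * C2)); last first.
      rewrite mulrAC ler_wpM2l ?mulr_ge0 // -ss lef_pV2 ?posrE ?exprn_gt0 //.
      by rewrite expr2 ler_peMl ?(ltW s0) // (le_trans t1).
    apply: le_trans (ler_wpM2l (divr_ge0 C10 (ler0n _ _)) (H2 _ M1)).
    rewrite mulr_sumr; apply: ler_sum => k _.
    have [_ h] := H1 M k M1 mM (ltn_ord k).
    rewrite /binw (_ : _ - _ = 2 ^- M * (`|s ^+ m * (krawp R M m)`_k|
      - 'C(M, k)%:R * `|(hermp R m).[binx R M k]|)); last by ring.
    rewrite (normrM (2 ^- M)) ger0_norm ?invr_ge0 ?exprn_ge0 //.
    rewrite (_ : C1 / M%:R * _ = 2 ^- M * ('C(M, k)%:R *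
      (C1 * (1 + `|binx R M k|) ^+ m / M%:R))); last by ring.
    rewrite ler_wpM2l ?invr_ge0 ?exprn_ge0 // (le_trans _ h) //.
    rewrite -/s (_ : _ * `|(hermp R m).[_]|
      = `|'C(M, k)%:R * (hermp R m).[binx R M k]|) ?ler_dist_dist //.
    by rewrite normrM normr_nat.
  have e2 := HD M M1.
  have e3 : `|T N.+1 - T M.+1| <= 2 * (C1 * C3) / s.
    have -> : T N.+1 - T M.+1 = - \sum_(k < M.+1 | (N < k)%N)
        (2 ^- M * `|s ^+ m * (krawp R M m)`_k|).
      rewrite {1}/T (big_ord_widen M.+1 (fun k => 2 ^- M *
        `|s ^+ m * (krawp R M m)`_k|)) ?ltnS ?leq_addr //.
      rewrite /T [X in _ - X](bigID (fun k : 'I__ => (k < N.+1)%N)) /=.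
      rewrite opprD addrA subrr sub0r; congr (- _).
      by apply: eq_bigl => k; rewrite -leqNgt.
    rewrite normrN (le_trans (ler_norm_sum _ _ _)) //.
    apply: (@le_trans _ _ (2 / s * C1 * C3)); last by rewrite le_eqVlt;
      apply/orP; left; apply/eqP; ring.
    have sC : 0 <= 2 / s * C1 by rewrite !mulr_ge0 // invr_ge0 ltW.
    apply: le_trans (ler_wpM2l sC (H3 _ M1)); rewrite mulr_sumr big_mkcond /=.
    apply: ler_sum => k _; case: ifPn => [Nk|_]; last first.
      by rewrite mulr_ge0 // mulr_ge0 ?binw_ge0 ?exprn_ge0 ?addr_ge0.
    have [h _] := H1 M k M1 mM (ltn_ord k); rewrite -/s in h.
    have [k2 k4] : (M <= 2 * k)%N /\ (M + 2 * M <= 2 * 2 * k)%N.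
      by rewrite /M; move: (nat_of_ord k) Nk mN => j; clear; split; lia.
    have x1 : 1 <= 2 / s * (1 + `|binx R M k|).
      rewrite -(ler_pM2l s0) mulr1 (mulrC 2) -mulrA mulVKf ?gt_eqF //.
      have sx : s * `|binx R M k| = 2 * k%:R - M%:R.
        rewrite -{1}(ger0_norm (ltW s0)) -normrM /binx -/s mulrC divfK ?gt_eqF
          //.
        rewrite ler0_norm ?opprB // subr_le0 -natrM ler_nat.
        exact: k2.
      have h2 : s * s <= s * (2 * `|binx R M k|).
        rewrite mulrCA sx -expr2 ss mulrBr mulrA -!natrM lerBrDr.
        by rewrite -natrD ler_nat.
      rewrite ler_pM2l // in h2; apply: le_trans h2 _.
      by rewrite ler_wpM2l // lerDr.
    rewrite normrM normr_id (ger0_norm (_ : 0 <= 2 ^- M)) ?invr_ge0 ?exprn_ge0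
      //.
    rewrite /binw (mulrC 'C(M, k)%:R) (_ : 2 / s * C1 * _ = 2 ^- M *
      ('C(M, k)%:R * (C1 * (1 + `|binx R M k|) ^+ m)
        * (2 / s * (1 + `|binx R M k|)))); last by rewrite exprS; ring.
    rewrite ler_wpM2l ?invr_ge0 ?exprn_ge0 // (le_trans h) // ler_peMr //.
    by rewrite !mulr_ge0 ?exprn_ge0 ?addr_ge0.
  have -> : T N.+1 - c = (T M.+1 -
      \sum_(k < M.+1) binw R M k * `|(hermp R m).[binx R M k]|)
    + (\sum_(k < M.+1) binw R M k * `|(hermp R m).[binx R M k]| - c)
    + (T N.+1 - T M.+1) by ring.
  rewrite (_ : E / s = C1 * C2 / s + D / s + 2 * (C1 * C3) / s); last first.
    by rewrite /E; ring.
  rewrite (le_trans (ler_normD _ _)) // lerD //.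
  by rewrite (le_trans (ler_normD _ _)) // lerD.
have m0 : 0 <= (2 ^+ m : R) by rewrite exprn_ge0.
have -> : 2 ^+ m / s ^+ m * T N.+1 - 2 ^+ m * c / t ^+ m
  = 2 ^+ m / s ^+ m * (T N.+1 - c) + - (2 ^+ m * c * (t ^- m - s ^- m)) by ring.
rewrite (le_trans (ler_normD _ _)) // mulrDl lerD //.
  rewrite normrM ger0_norm ?divr_ge0 ?exprn_ge0 ?(ltW s0) //.
  have s2 : 0 <= 2 ^+ m / s ^+ m by rewrite divr_ge0 ?exprn_ge0 ?(ltW s0).
  apply: (le_trans (ler_wpM2l s2 hT)).
  have -> : 2 ^+ m / s ^+ m * (E / s) = 2 ^+ m * E * (s ^- m * s^-1) by ring.
  rewrite -invfM -exprSr ler_wpM2l ?mulr_ge0 //.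
  by rewrite lef_pV2 ?posrE ?exprn_gt0 // lerXn2r ?nnegrE ?(ltW s0) ?(ltW t0).
(* Replacing [N + m] coins by [N] costs a relative error of order [1 / N]. *)
have z01 : 0 <= t / s <= 1.
  by rewrite divr_ge0 ?(ltW t0) ?(ltW s0) // ler_pdivrMr // mul1r.
have zE : t ^- m - s ^- m = t ^- m * (1 - (t / s) ^+ m).
  by rewrite exprMn exprVn; field; rewrite !expf_neq0 // gt_eqF.
have m2c := mulr_ge0 m0 c0.
rewrite normrN (normrM (2 ^+ m * c)) zE (ger0_norm m2c).
rewrite -[leRHS]mulrA ler_wpM2l //.
have /andP[z0 z1] := z01.
have tm0 : 0 <= t ^- m by rewrite invr_ge0 exprn_ge0 // ltW.
rewrite ger0_norm; last first.
  by rewrite mulr_ge0 // subr_ge0 exprn_ile1.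
rewrite exprSr invfM mulrCA ler_wpM2l //.
rewrite (le_trans (one_sub_expr_le m z01)) // -mulrA ler_wpM2l //.
apply: (@le_trans _ _ (1 - (t / s) ^+ 2)).
  by rewrite lerD2l lerN2 expr2 ler_piMl.
rewrite exprMn exprVn ss tt.
have -> : 1 - N%:R / M%:R = m%:R / M%:R :> R.
  by rewrite /M natrD; field; rewrite -natrD pnatr_eq0 -lt0n.
rewrite ler_wpM2l // -ss lef_pV2 ?posrE ?exprn_gt0 //.
by rewrite expr2 (le_trans ts) // ler_peMl ?(ltW s0) // (le_trans t1).
Qed.

(** * Uniqueness of the expansion *)

(** Convergence at one point at positive distance from 1 bounds the
coefficients geometrically, and the tail is dominated by a geometric series.
*)
Lemma power_series_remainder (R : realType) (a : nat -> R) (f : R -> R) m :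
  (\forall y \near (1 : R),
     series (fun r => a r * (y - 1) ^+ r) @ \oo --> f y) ->
  exists2 C, 0 <= C & exists2 d : R, 0 < d & forall y, `|y - 1| <= d ->
    `|f y - \sum_(r < m) a r * (y - 1) ^+ r| <= C * `|y - 1| ^+ m.
Proof.
case/nbhs_ballP => d /= d0 Hd.
pose u0 := d / 2; have u00 : 0 < u0 by rewrite divr_gt0.
have hu : ball (1 : R) d (1 + u0).
  rewrite /ball /= opprD addrA subrr sub0r normrN ger0_norm ?(ltW u00) //.
  by rewrite /u0 ltr_pdivrMr // ltr_pMr // ltr1n.
have u0d : u0 < d by rewrite /u0 ltr_pdivrMr // ltr_pMr // ltr1n.
clearbody u0.
have [C C0 HC] : exists2 C, 0 < C & forall r, `|a r * u0 ^+ r| <= C.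
  have c0 : (fun r => a r * (1 + u0 - 1) ^+ r) @ \oo --> (0 : R).
    by apply: cvg_series_cvg_0; apply/cvg_ex; exists (f (1 + u0)); exact: Hd.
  have /cvg_seq_bounded/pinfty_ex_gt0[C C0 HC] := cvgP _ c0.
  exists C => // r; have /= := HC r I.
  by rewrite (_ : 1 + u0 - 1 = u0) // addrAC subrr add0r.
exists (2 * C / u0 ^+ m) => [|].
  by rewrite divr_ge0 ?mulr_ge0 ?exprn_ge0 // ltW.
exists (u0 / 2) => [|y yd]; first by rewrite divr_gt0.
pose t := `|y - 1| / u0.
have t0 : 0 <= t by rewrite divr_ge0 // ltW.
have t2 : t <= 2^-1 by rewrite ler_pdivrMr // mulrC.
have term r : `|a r * (y - 1) ^+ r| <= C * t ^+ r.
  have -> : a r * (y - 1) ^+ r = (a r * u0 ^+ r) * ((y - 1) / u0) ^+ r.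
    have ur : u0 ^+ r != 0 by rewrite expf_neq0 // gt_eqF.
    rewrite exprMn exprVn; move: (u0 ^+ r) ur ((y - 1) ^+ r) => v v0 w.
    by field.
  rewrite (normrM (a r * _)) normrX (normrM (y - 1)) normfV.
  by rewrite (ger0_norm (ltW u00)) ler_wpM2r ?exprn_ge0.
have part n : (m <= n)%N ->
    `|series (fun r => a r * (y - 1) ^+ r) n - \sum_(r < m) a r * (y - 1) ^+ r|
    <= C * (2 * t ^+ m).
  move=> mn; rewrite /series /= -(big_mkord xpredT (fun r => a r * (y - 1) ^+
    r)).
  rewrite (@big_cat_nat _ _ _ m 0 n) //= addrAC subrr add0r.
  rewrite (le_trans (ler_norm_sum _ _ _)) //.
  apply: (@le_trans _ _ (C * (2 * (t ^+ m - t ^+ n)))); last first.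
    rewrite ler_wpM2l ?(ltW C0) // ler_wpM2l // gerBl exprn_ge0 //.
  have : \sum_(m <= r < n) t ^+ r <= 2 * (t ^+ m - t ^+ n).
    rewrite -(subnKC mn); elim: (n - m)%N => [|l IH].
      by rewrite addn0 big_geq // subrr mulr0.
    rewrite addnS big_nat_recr ?leq_addr //= exprS.
    have := ler_wpM2r (exprn_ge0 (m + l) t0) t2.
    by move: IH; lra.
  move=> /(ler_wpM2l (ltW C0)); apply: le_trans; rewrite mulr_sumr.
  by apply: ler_sum => r _; exact: term.
have yball : ball (1 : R) d y.
  rewrite /ball /= distrC (le_lt_trans yd) // (lt_trans _ u0d) //.
  by rewrite ltr_pdivrMr // ltr_pMr // ltr1n.
have -> : 2 * C / u0 ^+ m * `|y - 1| ^+ m = C * (2 * t ^+ m).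
  by rewrite /t exprMn exprVn; ring.
apply/ler_addgt0Pr => e e0.
have [N _ HN] := (cvgrPdist_le _ _).1 (Hd _ yball) e e0.
pose n := maxn N m.
have h1 := HN n (leq_maxl _ _); have h2 := part n (leq_maxr _ _).
rewrite [leRHS]addrC -[X in `|X|](subrKA (series (fun r => a r * (y - 1) ^+ r)
  n)).
by rewrite (le_trans (ler_normD _ _)) // lerD.
Qed.

(** One factor at a time: the bound makes [W] vanish at 1. The point 1 itself
is excluded from the hypothesis, because the bound for the quotient by [X - 1]
is inherited only away from 1. *)
Lemma dvdp_of_bound (R : realType) (W : {poly R}) (C d : R) k : 0 < d ->
  (forall y, 0 < `|y - 1| <= d -> `|W.[y]| <= C * `|y - 1| ^+ k) ->
  exists Q, W = Q * ('X - 1) ^+ k.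
Proof.
elim: k W => [|k IH] W d0 HW; first by exists W; rewrite expr0 mulr1.
have [Q WQ] : exists Q, W - (W.[1])%:P = Q * ('X - 1%:P).
  by apply/factor_theorem; rewrite /root hornerD hornerN hornerC subrr.
pose B := `|C| + norm1 Q * 3 ^+ size Q.
have B0 : 0 <= B by rewrite addr_ge0 // mulr_ge0 ?norm1_ge0 // exprn_ge0.
have W10 : W.[1] = 0.
  apply/eqP/contraT => W1; have W10 : 0 < `|W.[1]| by rewrite normr_gt0.
  pose u := Num.min (Num.min d 1) (`|W.[1]| / (2 * (B + 1))).
  have u0 : 0 < u.
    rewrite !lt_min d0 ltr01 /= divr_gt0 // mulr_gt0 // ltr_wpDl //.
  have [ud u1] : u <= d /\ u <= 1.
    by split; rewrite /u !ge_min lexx ?orbT.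
  have uB : u <= `|W.[1]| / (2 * (B + 1)) by rewrite /u ge_min lexx orbT.
  have yE : `|1 + u - 1| = u by rewrite addrAC subrr add0r ger0_norm // ltW.
  have h1 := HW (1 + u); rewrite yE u0 ud in h1; move/(_ isT) in h1.
  have h2 : `|W.[1 + u] - W.[1]| <= norm1 Q * 3 ^+ size Q * u.
    have -> : W.[1 + u] - W.[1] = Q.[1 + u] * u.
      have := congr1 (fun p => p.[1 + u]) WQ.
      rewrite /= hornerM !hornerD !hornerN !hornerC hornerX => ->.
      by congr (_ * _); rewrite addrAC subrr add0r.
    rewrite normrM (ger0_norm (ltW u0)) ler_wpM2r ?(ltW u0) //.
    rewrite (le_trans (horner_growth _ _)) // ler_wpM2l ?norm1_ge0 //.
    rewrite lerXn2r ?nnegrE ?addr_ge0 // ger0_norm ?addr_ge0 ?(ltW u0) //.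
    by move: u1; clear; lra.
  have h3 : `|W.[1]| <= B * u.
    rewrite -[X in `|X|](subKr W.[1 + u]) (le_trans (ler_normB _ _)) //.
    rewrite mulrDl lerD // (le_trans h1) // exprS.
    rewrite (le_trans (ler_norm _)) // normrM ler_wpM2l //.
    by rewrite ger0_norm ?mulr_ge0 ?exprn_ge0 ?(ltW u0) // ler_piMr ?(ltW u0)
      // exprn_ile1 // ltW.
  have h4 := le_trans h3 (ler_wpM2l B0 uB).
  have : `|W.[1]| < `|W.[1]|; last by rewrite ltxx.
  apply: (le_lt_trans h4); rewrite mulrCA gtr_pMr // ltr_pdivrMr; last first.
    by rewrite mulr_gt0 // ltr_wpDl.
  by rewrite mul1r; lra.
have [Q' QE] : exists Q', Q = Q' * ('X - 1) ^+ k.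
  apply: IH => // y /andP[y0 yd].
  have := HW y; rewrite y0 yd => /(_ isT).
  rewrite -[W](subrK (W.[1])%:P) WQ W10 addr0 hornerM hornerXsubC normrM.
  by rewrite exprSr mulrA ler_pM2r.
exists Q'; rewrite exprSr mulrA -QE -polyC1 -WQ W10 polyC0 subr0 //.
Qed.

(** [binpoly R N] does not vanish at 1, hence is prime to [X - 1], so that the
difference of [A] and [B], of degree less than [m], would be divisible by
[X^m]. *)
Lemma taylor_unique (R : realType) (P A B QA QB : {poly R}) (N m : nat) :
  (size A <= m)%N -> (size B <= m)%N ->
  P - binpoly R N * (A \Po ('X - 1)) = QA * ('X - 1) ^+ m ->
  P - binpoly R N * (B \Po ('X - 1)) = QB * ('X - 1) ^+ m -> A = B.
Proof.
move=> sA sB hA hB; apply/eqP; rewrite -subr_eq0.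
have sAB : (size (A - B)%R <= m)%N.
  by rewrite (leq_trans (size_polyD _ _)) // geq_max sA size_polyN.
have E : binpoly R N * ((A - B) \Po ('X - 1)) = (QB - QA) * ('X - 1) ^+ m.
  by rewrite mulrBl -hA -hB rmorphB /= mulrBr; ring.
have cop : coprimep (('X - 1%:P) ^+ m) (binpoly R N).
  rewrite coprimep_expl // coprimep_sym coprimep_XsubC /root /binpoly.
  rewrite horner_exp hornerZ hornerD hornerC hornerX expf_eq0 negb_and.
  by rewrite mulf_neq0 ?orbT // -natrD pnatr_eq0.
have dv : ('X - 1%:P) ^+ m %| (A - B) \Po ('X - 1).
  by rewrite -(Gauss_dvdpr _ cop) E polyC1 dvdp_mull.
have c0 : (A - B) \Po ('X - 1) = 0.
  apply/eqP/contraT => n0; have := dvdp_leq n0 dv.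
  rewrite size_exp_XsubC -polyC1 size_comp_poly2 ?size_XsubC // => h.
  by move: (leq_trans h sAB); rewrite ltnn.
by rewrite -(comp_poly_eq0 (A - B) (q := 'X - 1)) ?c0 // -polyC1 size_XsubC.
Qed.

(** * The remainder, uniformly in the integer *)

(** Each digit block contributes its own Taylor polynomial, with a remainder
that has the full smoothness of [lambda n - j] coins; the weights [2 ^- j]
make up for losing [j] coins. *)
Lemma genpoly_taylor (R : realType) (mu : nat -> nat) (m : nat) :
  mu 0%N = 0%N ->
  (forall n, (1 <= n)%N -> genpoly R mu (2 * n) = (1 + 'X) * genpoly R mu n) ->
  exists2 C : R, 0 <= C & forall n, (1 <= n)%N -> exists A Q : {poly R},
  [/\ (size A <= m.+1)%N,
      (forall r, `|A`_r| <= C),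
      n%:R^-1 *: genpoly R mu n - binpoly R (lambda n) * (A \Po ('X - 1))
        = Q * ('X - 1) ^+ m.+1 &
      norm1 (n%:R^-1 *: genpoly R mu n
        - binpoly R (lambda n) * (A \Po ('X - 1)))
      <= C / Num.sqrt (lambda n).+1%:R ^+ m.+1].
Proof.
move=> mu0 Hd.
have [C1 C10 H1] := norm1_diffpoly R m.+1.
have [C2 C20 H2] := taylor_quotient R m.
have [C3 C30 H3] := sum_pow_geometric R (m + m.+1 + m.+1).
have [C4 C40 H4] := sum_pow_geometric R m.
exists (C1 * C2 * C3 + C2 * C4) => [|n n1].
  by rewrite addr_ge0 // !mulr_ge0.
have [e [c [cj Sn]]] := genpoly_digits mu0 Hd n1.
have /choice [AQ HAQ] : forall j, exists AQ : {poly R} * {poly R},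
  [/\ (size AQ.1 <= m.+1)%N,
      (forall r, `|AQ.1`_r| <= C2 * j.+1%:R ^+ m),
      'X^(c j) - binpoly R j * (AQ.1 \Po ('X - 1)) = AQ.2 * ('X - 1) ^+ m.+1 &
      norm1 AQ.2 <= C2 * j.+1%:R ^+ (m + m.+1)].
  by move=> j; have [A [Q h]] := H2 j (c j) (cj j); exists (A, Q).
set l := lambda n in Sn *.
have n0 : 0 < n%:R :> R by rewrite ltr0n.
have ln : 2 ^+ l <= n%:R :> R.
  by rewrite -natrX ler_nat /l /lambda trunc_logP.
pose w j : R := (e j)%:R * 2 ^+ (l - j) / n%:R.
have w0 j : 0 <= w j by rewrite divr_ge0 // mulr_ge0 // exprn_ge0.
have w2 j : (j <= l)%N -> w j <= 2 ^- j.
  move=> jl; rewrite /w ler_pdivrMr //.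
  apply: (@le_trans _ _ (2 ^+ (l - j))).
    by rewrite ler_piMl ?exprn_ge0 //; case: (e j).
  rewrite mulrC ler_pdivlMr ?exprn_gt0 // -exprD subnK //.
pose A := \sum_(j < l.+1) w j *: (AQ j).1.
pose Q := \sum_(j < l.+1) w j *: (binpoly R (l - j) * (AQ j).2).
have QE : n%:R^-1 *: genpoly R mu n - binpoly R l * (A \Po ('X - 1))
    = Q * ('X - 1) ^+ m.+1.
  rewrite Sn scaler_sumr /A raddf_sum mulr_sumr -sumrB /Q mulr_suml /=.
  apply: eq_bigr => j _; have jl : (j <= l)%N by rewrite -ltnS.
  have [_ _ hQ _] := HAQ j.
  rewrite -scalerAl -mulrA -hQ comp_polyZ -scalerAr mulrBr scalerBr.
  rewrite [in RHS]mulrA -binpolyD subnK //; congr (_ - _).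
  rewrite /binpoly exprZn -scalerAl !scalerA; congr (_ *: _).
  rewrite /w exprVn; field.
  by rewrite expf_neq0 ?pnatr_eq0 //= gt_eqF.
(* [l + 1 <= (l - j + 1) (j + 1)] *)
have js j : (j <= l)%N -> (Num.sqrt (l - j).+1%:R ^+ m.+1)^-1
    <= j.+1%:R ^+ m.+1 / Num.sqrt l.+1%:R ^+ m.+1 :> R.
  move=> jl; set a := Num.sqrt (l - j).+1%:R; set b := Num.sqrt l.+1%:R.
  have a0 : 0 < a by exact: sqrt_nat_gt0.
  have b0 : 0 < b by exact: sqrt_nat_gt0.
  rewrite -exprVn -exprVn -exprMn lerXn2r ?nnegrE ?mulr_ge0 ?invr_ge0 ?(ltW
    a0) ?(ltW b0) //.
  rewrite ler_pdivlMr // ler_pdivrMl //.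
  rewrite -ler_sqr ?nnegrE ?mulr_ge0 ?(ltW a0) ?(ltW b0) //.
  rewrite exprMn !sqr_sqrt_nat -natrX -natrM ler_nat.
  by move: jl; clear; nia.
have Ar r : `|A`_r| <= C2 * C4.
  rewrite /A coef_sum (le_trans (ler_norm_sum _ _ _)) //.
  apply: le_trans (ler_wpM2l C20 (H4 l.+1)); rewrite mulr_sumr.
  apply: ler_sum => j _; have [_ h _ _] := HAQ j.
  rewrite coefZ normrM (ger0_norm (w0 j)) mulrA mulrC.
  by rewrite ler_pM // w2 // -ltnS.
exists A, Q; split => //.
- rewrite /A; elim/big_ind: _ => [|p q sp sq|j _]; first by rewrite size_poly0.
    by rewrite (leq_trans (size_polyD _ _)) // geq_max sp.
  by have [h _ _ _] := HAQ j; rewrite (leq_trans (size_scale_leq _ _)).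
- by move=> r; rewrite (le_trans (Ar r)) // lerDr !mulr_ge0.
rewrite QE (@le_trans _ _ (C1 * C2 * C3 / Num.sqrt l.+1%:R ^+ m.+1)) //; last
  first.
  rewrite ler_wpM2r ?invr_ge0 ?exprn_ge0 ?sqrtr_ge0 // lerDl mulr_ge0 //.
rewrite /Q mulr_suml (le_trans (ler_norm1_sum _ _ _)) //.
have K0 : 0 <= C1 * C2 / Num.sqrt l.+1%:R ^+ m.+1.
  by rewrite divr_ge0 ?mulr_ge0 ?exprn_ge0 ?sqrtr_ge0.
rewrite mulrAC (le_trans _ (ler_wpM2l K0 (H3 l.+1))) // mulr_sumr.
apply: ler_sum => j _; have jl : (j <= l)%N by rewrite -ltnS.
have [_ _ _ hQ] := HAQ j.
rewrite -scalerAl norm1Z (ger0_norm (w0 j)) (mulrAC (binpoly R _)) -/(diffpoly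
  R (l - j) m.+1).
rewrite (le_trans (ler_wpM2l (w0 j) (ler_norm1M _ _))) //.
apply: (@le_trans _ _ (2 ^- j * ((C1 * (j.+1%:R ^+ m.+1 /
    Num.sqrt l.+1%:R ^+ m.+1)) * (C2 * j.+1%:R ^+ (m + m.+1))))).
  apply: ler_pM => //; first by rewrite mulr_ge0 ?norm1_ge0.
    exact: w2.
  apply: ler_pM; rewrite ?norm1_ge0 // (le_trans (H1 _)) //.
  by rewrite ler_wpM2l // js.
by rewrite (exprD _ (m + m.+1)) le_eqVlt; apply/orP; left; apply/eqP; ring.
Qed.

(** * Proof of the theorem *)

Definition expansion_poly (R : realType) (b : nat -> nat -> R) (n m : nat) :
  {poly R} :=
  \poly_(r < m) b r n.

Lemma binpoly_horner (R : realType) N (y : R) :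
  (binpoly R N).[y] = ((1 + y) / 2) ^+ N.
Proof.
by rewrite /binpoly horner_exp hornerZ hornerD hornerC hornerX mulrC.
Qed.

(** Multiplying the expansion by [((1 + y) / 2) ^+ lambda n] turns its analytic
remainder into a polynomial of order [m] at 1, which no longer mentions
convergence. *)
Lemma expansion_remainder (R : realType) (mu : nat -> nat)
    (b : nat -> nat -> R) n m : is_expansion mu b n ->
  exists Q, n%:R^-1 *: genpoly R mu n
    - binpoly R (lambda n) * (expansion_poly b n m \Po ('X - 1))
    = Q * ('X - 1) ^+ m.
Proof.
move=> /(power_series_remainder m) [C C0 [d d0 H]].
apply: (dvdp_of_bound (C := 2 ^+ lambda n * C) (d := Num.min d 1)).
  by rewrite lt_min d0 ltr01.
move=> y /andP[_]; rewrite le_min => /andP[yd y1].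
have := H y yd; rewrite pgfZ_genpoly => h.
have [z0 z2] : 0 < (1 + y) / 2 /\ (1 + y) / 2 <= 2.
  by move: y1; rewrite ler_norml; clear; split; lra.
rewrite hornerD hornerN hornerM binpoly_horner horner_comp horner_poly.
rewrite hornerD hornerN hornerX hornerC.
set z := (1 + y) / 2 in h z0 z2 *; set S := \sum_(r < m) _ in h *.
have -> : (n%:R^-1 *: genpoly R mu n).[y] - z ^+ lambda n * S
    = z ^+ lambda n * ((n%:R^-1 *: genpoly R mu n).[y] * z ^- lambda n - S).
  by rewrite mulrBr mulrCA divff ?mulr1 // expf_neq0 // gt_eqF.
rewrite normrM -mulrA ler_pM // normrX (ger0_norm (ltW z0)).
by rewrite lerXn2r ?nnegrE // ltW.
Qed.

Lemma lambda_double n : (1 <= n)%N -> lambda (2 * n) = (lambda n).+1.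
Proof. by move=> n1; rewrite /lambda -[(2 * n)%N]addn0 (trunc_log2_double
  false). Qed.

Lemma expansion_double (R : realType) (mu : nat -> nat) (b : nat -> nat -> R) :
  (forall n, (1 <= n)%N -> genpoly R mu (2 * n) = (1 + 'X) * genpoly R mu n) ->
  (forall n, (1 <= n)%N -> is_expansion mu b n) ->
  forall r n, (1 <= n)%N -> b r n = b r (2 * n)%N.
Proof.
move=> Hd Hb r n n1.
have [Q1 E1] := expansion_remainder r.+1 (Hb n n1).
have n2 : (1 <= 2 * n)%N by rewrite muln_gt0.
have [Q2 E2] := expansion_remainder r.+1 (Hb (2 * n)%N n2).
have n0 : n%:R != 0 :> R by rewrite pnatr_eq0 -lt0n.
rewrite lambda_double // in E2.
have P2 : (2 * n)%:R^-1 *: genpoly R mu (2 * n)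
    = binpoly R 1 * (n%:R^-1 *: genpoly R mu n).
  rewrite Hd // /binpoly expr1 natrM invfM -scalerAl -scalerAr scalerA.
  by congr (_ *: _).
have E1' : (2 * n)%:R^-1 *: genpoly R mu (2 * n)
    - binpoly R (lambda n).+1 * (expansion_poly b n r.+1 \Po ('X - 1))
    = (binpoly R 1 * Q1) * ('X - 1) ^+ r.+1.
  by rewrite -mulrA -E1 mulrBr mulrA -binpolyD add1n P2.
have := taylor_unique (size_poly _ _) (size_poly _ _) E1' E2.
move=> /(congr1 (fun p : {poly R} => p`_r)).
by rewrite /expansion_poly !coef_poly ltnSn.
Qed.

(** The sign [(-1) ^+ r] reconciles the factors [1 - X] of the differences with
the powers of [X - 1] of the expansion. *)
Lemma coef_diffpoly (R : realType) (N r k : nat) :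
  (diffpoly R N r)`_k = (-1) ^+ r * 2 ^- N * diff_bin R r N k.
Proof.
have -> : diffpoly R N r = ((-1) ^+ r * 2 ^- N) *:
    \sum_(l < r.+1) ('C(r, l)%:R * (-1) ^+ l) *: ('X^l * (1 + 'X) ^+ N).
  rewrite diffpolyE /krawp addnK.
  congr (_ *: _); rewrite exprDn mulr_suml; apply: eq_bigr => l _.
  rewrite expr1n mul1r -scaleN1r exprZn -scaler_nat scalerA.
  by rewrite -scalerAl.
rewrite coefZ coef_sum /diff_bin; congr (_ * _); apply: eq_bigr => l _.
rewrite coefZ coefXnM; congr (_ * _); rewrite ltnNge; case: leqP => //= _.
by rewrite coef_1addXn.
Qed.

Lemma l1_errorE (R : realType) (mu : nat -> nat) (b : nat -> nat -> R) m n :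
  l1_error mu b m n = \sum_(k < (lambda n).+1)
    `|(n%:R^-1 *: genpoly R mu n
       - binpoly R (lambda n) * (expansion_poly b n m \Po ('X - 1)))`_k|.
Proof.
apply: eq_bigr => k _; rewrite prZ_genpoly coefB; congr `| _ - _|.
rewrite /expansion_poly poly_def raddf_sum mulr_sumr coef_sum /=.
apply: eq_bigr => r _; rewrite comp_polyZ comp_Xn_poly -scalerAr coefZ.
by rewrite -/(diffpoly R (lambda n) r) coef_diffpoly; ring.
Qed.

Lemma sum_coef_le_norm1 (R : realType) (p : {poly R}) K :
  \sum_(k < K) `|p`_k| <= norm1 p.
Proof.
rewrite (@norm1E _ p (maxn K (size p))) ?leq_maxr //.
rewrite (big_ord_widen (maxn K (size p)) (fun k => `|p`_k|)) ?leq_maxl //.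
by rewrite big_mkcond /=; apply: ler_sum => k _; case: ifP.
Qed.

Lemma powR_half (R : realType) (x : R) m : 0 <= x ->
  x `^ (m%:R / 2) = Num.sqrt x ^+ m.
Proof.
by move=> x0; rewrite mulrC powRrM powR12_sqrt // powR_mulrn // sqrtr_ge0.
Qed.

(** The term of order [m] of the expansion is split off from the remainder of
order [m + 1]: the former gives the main term by [sum_diffpoly_asymp], the
latter is [genpoly_taylor]. *)
Lemma l1_error_asymp (R : realType) (mu : nat -> nat) (b : nat -> nat -> R) m :
  mu 0%N = 0%N ->
  (forall n, (1 <= n)%N -> genpoly R mu (2 * n) = (1 + 'X) * genpoly R mu n) ->
  (forall n, (1 <= n)%N -> is_expansion mu b n) ->
  exists C : R, forall n, (1 <= n)%N -> (1 <= lambda n)%N ->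
    (3 * m <= lambda n)%N ->
    `|l1_error mu b m n
      - hconst R m * `|b m n| / Num.sqrt (lambda n)%:R ^+ m|
    <= C / Num.sqrt (lambda n)%:R ^+ m.+1.
Proof.
move=> mu0 Hd Hb.
have [C1 C10 H1] := genpoly_taylor m mu0 Hd.
have [C2 C20 H2] := sum_diffpoly_asymp R m.
exists (C1 + C1 * C2) => n n1 l1 lm.
have [A [Q [sA Abnd AE Anorm]]] := H1 n n1.
have [Q' BE] := expansion_remainder m.+1 (Hb n n1).
have AB : A = expansion_poly b n m.+1 := taylor_unique sA (size_poly _ _) AE BE.
have bm : `|b m n| <= C1.
  by have := Abnd m; rewrite AB /expansion_poly coef_poly ltnSn.
rewrite {}AB in Anorm.
set l := lambda n in l1 lm Anorm *; set t := Num.sqrt l%:R.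
have t0 : 0 < t by exact: sqrt_nat_gt0.
set P := n%:R^-1 *: _ in Anorm *.
pose rem := P - binpoly R l * (expansion_poly b n m.+1 \Po ('X - 1)).
have remE : P - binpoly R l * (expansion_poly b n m \Po ('X - 1))
    = rem + b m n *: diffpoly R l m.
  rewrite /rem; have -> : expansion_poly b n m.+1 = expansion_poly b n m + b m
    n *: 'X^m.
    by rewrite /expansion_poly !poly_def big_ord_recr.
  rewrite comp_polyD comp_polyZ comp_Xn_poly mulrDr -scalerAr.
  by rewrite opprD addrA subrK.
have e1 : `|l1_error mu b m n - `|b m n| * \sum_(k < l.+1) `|(diffpoly R l
  m)`_k| |
    <= C1 / t ^+ m.+1.
  rewrite l1_errorE -/l -/P remE mulr_sumr -sumrB.
  rewrite (le_trans (ler_norm_sum _ _ _)) //.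
  apply: (@le_trans _ _ (\sum_(k < l.+1) `|rem`_k|)).
    apply: ler_sum => k _; rewrite coefD coefZ -normrM.
    by rewrite (le_trans (ler_dist_dist _ _)) // addrK.
  rewrite (le_trans (sum_coef_le_norm1 _ _)) // (le_trans Anorm) //.
  rewrite ler_wpM2l // lef_pV2 ?posrE ?exprn_gt0 ?sqrt_nat_gt0 //.
  rewrite lerXn2r ?nnegrE ?sqrtr_ge0 //.
  by rewrite ler_sqrt ?ler0n // ler_nat.
have e2 := ler_wpM2l (normr_ge0 (b m n)) (H2 l l1 lm).
rewrite -/t -(normr_id (b m n)) -normrM mulrBr !normr_id in e2.
have -> : l1_error mu b m n - hconst R m * `|b m n| / t ^+ m
    = (l1_error mu b m n - `|b m n| * \sum_(k < l.+1) `|(diffpoly R l m)`_k|)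
    + (`|b m n| * (\sum_(k < l.+1) `|(diffpoly R l m)`_k|)
       - `|b m n| * (hconst R m / t ^+ m)) by ring.
rewrite mulrDl (le_trans (ler_normD _ _)) // lerD // (le_trans e2) //.
by rewrite mulrA ler_wpM2r ?invr_ge0 ?exprn_ge0 ?(ltW t0) // ler_wpM2r.
Qed.


Theorem theorem4p2 (R : realType) (code : nat -> seq bool)
  (code_inj : injective code)
  (mu0 : ones code 0 = 0%N)
  (Hdouble : forall n : nat, (1 <= n)%N -> doubling R (ones code) n)
  (b : nat -> nat -> R)
  (Hb : forall n : nat, (1 <= n)%N -> is_expansion (ones code) b n) :
  (forall r n : nat, (1 <= n)%N -> b r n = b r (2 * n)%N) /\
  (forall m : nat, (1 <= m)%N ->
     (fun n : nat => l1_error (ones code) b m n : R^o)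
     = (fun n : nat =>
          hconst R m * `|b m n| / (lambda n)%:R `^ (m%:R / 2) : R^o)
     +O_\oo
       (fun n : nat => (lambda n)%:R `^ (- (m.+1%:R / 2)) : R^o)).
Proof.
have Hd n (n1 : (1 <= n)%N) := genpoly_double n1 (Hdouble n n1).
split; first exact: expansion_double Hd Hb.
(* [n >= 2 ^ (3 m)] makes [lambda n] large enough for [l1_error_asymp]. *)
move=> m m1; have [C HC] := l1_error_asymp m mu0 Hd Hb.
apply/eqaddOP; near=> K; near=> n.
have nK : (2 ^ (3 * m) <= n)%N by near: n; exact: nbhs_infty_ge.
have n1 : (1 <= n)%N by rewrite (leq_trans _ nK) // expn_gt0.
have lm : (3 * m <= lambda n)%N by exact: trunc_log_max.
have l1 : (1 <= lambda n)%N.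
  by rewrite (leq_trans _ lm) // muln_gt0.
have l0 : 0 <= (lambda n)%:R :> R by [].
have := HC n n1 l1 lm.
rewrite -powR_half // => h.
rewrite [X in X <= _](_ : _ = `|l1_error (ones code) b m n -
  hconst R m * `|b m n| / (lambda n)%:R `^ (m%:R / 2)|) //.
rewrite (le_trans h) // powRN powR_half //.
set u := _ ^- _; have u0 : 0 <= u by rewrite invr_ge0 exprn_ge0 // sqrtr_ge0.
rewrite (ger0_norm u0) ler_wpM2r //.
Unshelve. all: by end_near. Qed.
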